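(* Let $m\ge1$, let $G:\mathbb{R}\to\mathfrak{L}_n$ be Lipschitz continuous with respect to $d_\mu$, let $h>0$, $\delta\in[0,h)$, and suppose $F_i^0=G(\delta+ih)\in\mathfrak{J}_n$ for all $i\in\mathbb{Z}$. Let $F_k$ be the level-$k$ piecewise interpolants of the degree-$m$ set-valued spline scheme applied to $\{F_i^0\}$, reparametrized to the sample grid, i.e. $\widetilde F_k(x)=F_k((x-\delta)/h)$. Then there is a constant $C$ depending only on $m$ and on the Lipschitz constant of $G$ such that $d_\mu(G(x),\widetilde F_k(x))\le Ch$ for all $x\in\mathbb{R}$ and all $k\ge0$.
   Context: Notation: $\mu$ is $n$-dimensional Lebesgue measure; $\operatorname{ci}(E)$ is the closure of the interior of $E$; $\mathfrak{J}_n$ is the family of bounded sets $A\subset\mathbb{R}^n$ with $A=\operatorname{ci}(A)$ and $\mu(\partial A)=0$ (the empty set included); $d_\mu(A,B)=\mu(A\triangle B)$. $\mathfrak{L}_n$ is the complete metric space of Lebesgue measurable subsets of $\mathbb{R}^n$ of finite measure, with metric $d_\mu$ and sets differing by a null set identified; $\mathfrak{J}_n\subset\mathfrak{L}_n$. For nonempty bounded $A$: $d_S(p,A)=d(p,\partial A)$ if $p\in A$, $-d(p,\partial A)$ if $p\notin A$, where $d(q,E)=\min_{e\in E}\|q-e\|$. $O(B,r)=\{p:d(p,B)\le r\}$ for $r\ge0$. Distance average: for nonempty $A,B\in\mathfrak{J}_n$, $x\in\mathbb{R}$, $xA\,\widetilde\oplus\,(1-x)B=\{p: x d_S(p,A)+(1-x)d_S(p,B)\ge0\}$;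 if $A\ne\emptyset=B$, fix $q\in A$ maximizing $d_S(\cdot,A)$ over $A$ and set $xA\,\widetilde\oplus\,(1-x)B=\{p: x d_S(p,A)+(x-1)\|p-q\|\ge0\}$; the distance average of two empty sets is $\emptyset$. Let $h_{A,B}(x)=\mu(xA\,\widetilde\oplus\,(1-x)B)$. $A,B$ satisfy the zero-measure condition if $\mu(\{p: \tfrac12 d_S(p,A)+\tfrac12 d_S(p,B)=0\})=0$. Measure average $tA\oplus(1-t)B$ ($t\in\mathbb{R}$), defined in three steps (a fixed large number $N>0$ and, where needed, a fixed $\varepsilon>0$ are chosen once). Always $tA\oplus(1-t)A=A$. Step 1 (simply different: $B\subsetneq A$, $A\setminus B$ connected). If $A,B$ satisfy the zero-measure condition, or if $t\notin[0,1]$: $tA\oplus(1-t)B=\operatorname{ci}\big(gA\,\widetilde\oplus\,(1-g)B\big)$ where $g\in[-N,N]$ is any point attaining $\inf_{\xi\in[-N,N]}|h_{A,B}(\xi)-(t\mu(A)+(1-t)\mu(B))|$ (the set obtained does not depend on this choice). If the zero-measure condition fails and $t\in[0,1]$: $tA\oplus(1-t)B=\operatorname{ci}(O(B,r)\cap A)$ for any $r\ge0$ with $\mu(O(B,r)\cap A)=t\mu(A)+(1-t)\mu(B)$. Step 2 (nested: $B\subsetneq A$). If $A\setminus B$ has finitely many connected components, for each component $C$ let $R_{C,t}=t(B\cup C)\oplus(1-t)B$ (Step 1), and set $tA\oplus(1-t)B=\bigcup_C R_{C,t}$ for $t\ge0$ and $\operatorname{ci}\big(\bigcap_C R_{C,t}\big)$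 for $t<0$. If there are infinitely many components, all components of measure $<\varepsilon$ are merged into one set $U$, which is treated as a single component in these formulas. Step 3 (general $A,B$). Let $I=\operatorname{ci}(A\cap B)$, $R_{1,t}=tA\oplus(1-t)I$ and $R_{2,t}=(1-t)B\oplus tI$ (Step 2 averages of nested pairs, weight first on the larger set). Then $tA\oplus(1-t)B=R_{1,t}\cup R_{2,t}$ for $t\in[0,1]$; $=\operatorname{ci}(R_{1,t}\setminus(A\cap B))\cup R_{2,t}$ for $t>1$; and for $t<0$ it is defined as $(1-t)B\oplus tA$, computed by the $t>1$ rule with the roles of $A$ and $B$ exchanged (parameter $1-t>1$). Set-valued spline scheme of degree $m\ge1$: given $\{F_i^k\}_{i\in\mathbb{Z}}\subset\mathfrak{J}_n$, set $F_{2i}^{k+1,0}=F_i^k$, $F_{2i+1}^{k+1,0}=\tfrac12F_i^k\oplus\tfrac12F_{i+1}^k$; for $j=1,\dots,m-1$, $F_i^{k+1,j}=\tfrac12F_i^{k+1,j-1}\oplus\tfrac12F_{i+1}^{k+1,j-1}$; and $F_i^{k+1}=F^{k+1,m-1}_{i-\lfloor(m-1)/2\rfloor}$ ($i\in\mathbb{Z}$, $k=0,1,\dots$). The level-$k$ piecewise interpolant is $F_k(x)=\lambda(x)F_i^k\oplus(1-\lambda(x))F_{i+1}^k$ for $i2^{-k}\le x\le(i+1)2^{-k}$, with $\lambda(x)=(i+1)-x2^k$. *)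

(* Defs.v *)
From HB Require Import structures.
From mathcomp Require Import all_boot all_order all_algebra.
From mathcomp Require Import all_classical all_reals all_analysis.
Set Implicit Arguments. Unset Strict Implicit. Unset Printing Implicit Defensive.
Import Order.TTheory GRing.Theory Num.Theory.
Import numFieldNormedType.Exports.
Local Open Scope classical_set_scope.
Local Open Scope ring_scope.

Section SetAverages.
Variables (R : realType) (n : nat).
Local Notation pt := 'rV[R]_n.

Definition enorm (p : pt) : R := Num.sqrt (\sum_(i < n) (p ord0 i) ^+ 2).

(* d(q,E) = min_{e in E} ||q - e||  (written as an infimum; it is a min for
   closed nonempty E) *)
Definition edist (q : pt) (E : set pt) : R := inf [set enorm (q - e) | e in E].

Definition ci (E : set pt) : set pt := closure (interior E).
Definition bdry (E : set pt) : set pt := closure E `\` interior E.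

Definition bounded_pt (A : set pt) : Prop :=
  exists M : R, forall p, A p -> enorm p <= M.

Definition box (a b : pt) : set pt :=
  [set p | forall i, a ord0 i <= p ord0 i <= b ord0 i].
Definition vol (a b : pt) : R := \prod_(i < n) Num.max (b ord0 i - a ord0 i) 0.
Definition leb (A : set pt) : \bar R :=
  ereal_inf [set s | exists a b : nat -> pt,
     A `<=` \bigcup_k box (a k) (b k) /\ s = (\sum_(k <oo) (vol (a k) (b k))%:E)%E].

Definition leb_measurable (A : set pt) : Prop :=
  forall X : set pt, leb X = (leb (X `&` A) + leb (X `\` A))%E.

Definition symdiff (A B : set pt) : set pt := (A `\` B) `|` (B `\` A).
Definition dmu (A B : set pt) : \bar R := leb (symdiff A B).

Definition isJ (A : set pt) : Prop :=
  bounded_pt A /\ A = ci A /\ leb (bdry A) = 0%E.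

Definition dS (p : pt) (A : set pt) : R :=
  if `[< A p >] then edist p (bdry A) else - edist p (bdry A).

Definition center (A : set pt) : pt :=
  xget 0 [set q | A q /\ forall p, A p -> dS p A <= dS q A].

Definition davg_fun (x : R) (A B : set pt) (p : pt) : R :=
  if `[< A !=set0 >] then
    if `[< B !=set0 >] then x * dS p A + (1 - x) * dS p B
    else x * dS p A + (x - 1) * enorm (p - center A)
  else if `[< B !=set0 >] then (1 - x) * dS p B + ((1 - x) - 1) * enorm (p - center B)
  else -1.

Definition davg (x : R) (A B : set pt) : set pt := [set p | 0 <= davg_fun x A B p].

Definition hAB (A B : set pt) (x : R) : \bar R := leb (davg x A B).

Definition zero_measure_cond (A B : set pt) : Prop :=
  leb [set p | davg_fun (2^-1) A B p = 0] = 0%E.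

Definition Onbhd (B : set pt) (r : R) : set pt := [set p | edist p B <= r].

Variables (N eps : R).

Definition avg1 (t : R) (A B : set pt) : set pt :=
  let tg := t * fine (leb A) + (1 - t) * fine (leb B) in
  if `[< zero_measure_cond A B \/ ~ (0 <= t <= 1) >] then
    ci (davg (xget 0 [set g | -N <= g <= N /\
            forall xi, -N <= xi <= N ->
              `|fine (hAB A B g) - tg| <= `|fine (hAB A B xi) - tg| ]) A B)
  else
    ci (Onbhd B (xget 0 [set r | 0 <= r /\ leb (Onbhd B r `&` A) = tg%:E]) `&` A).

Definition components (A B : set pt) : set (set pt) :=
  [set C | exists p, (A `\` B) p /\ C = connected_component (A `\` B) p].

Definition comp_family (A B : set pt) : set (set pt) :=
  if `[< finite_set (components A B) >] then components A B
  else [set C | components A B C /\ (eps%:E <= leb C)%E] `|`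
       [set \bigcup_(C in [set C | components A B C /\ (leb C < eps%:E)%E]) C].

Definition avg2 (t : R) (A B : set pt) : set pt :=
  if `[< 0 <= t >] then \bigcup_(C in comp_family A B) avg1 t (B `|` C) B
  else ci (\bigcap_(C in comp_family A B) avg1 t (B `|` C) B).

(* sX (+) (1-s)Y for Y a subset of X (equal or nested) *)
Definition avg2e (s : R) (X Y : set pt) : set pt :=
  if `[< X = Y >] then X else avg2 s X Y.

Definition mavg (t : R) (A B : set pt) : set pt :=
  if `[< A = B >] then A
  else if `[< B `<=` A >] then avg2 t A B
  else if `[< A `<=` B >] then avg2 (1 - t) B A
  else let I := ci (A `&` B) in
    if `[< 0 <= t <= 1 >] then avg2e t A I `|` avg2e (1 - t) B I
    else if `[< 1 < t >] then ci (avg2e t A I `\` (A `&` B)) `|` avg2e (1 - t) B I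
    else ci (avg2e (1 - t) B I `\` (B `&` A)) `|` avg2e t A I.

Definition refine0 (F : int -> set pt) (j : int) : set pt :=
  if (j %% 2)%Z == 0 then F (j %/ 2)%Z
  else mavg (2^-1) (F (j %/ 2)%Z) (F ((j %/ 2)%Z + 1)).

Definition avgstep (F : int -> set pt) (i : int) : set pt :=
  mavg (2^-1) (F i) (F (i + 1)).

Definition spline_step (m : nat) (F : int -> set pt) (i : int) : set pt :=
  iter m.-1 avgstep (refine0 F) (i - ((m.-1)./2)%:Z).

Definition spline_level (m : nat) (F0 : int -> set pt) (k : nat) : int -> set pt :=
  iter k (spline_step m) F0.

Definition interp (m : nat) (F0 : int -> set pt) (k : nat) (x : R) : set pt :=
  let i := Num.floor (x * 2 ^+ k) in
  let lam := (i + 1)%:~R - x * 2 ^+ k in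
  mavg lam (spline_level m F0 k i) (spline_level m F0 k (i + 1)).

End SetAverages.

(* Main.v *)
(* For t in [0, 1] the average M of A and B satisfies d(M, A) <= (1 - t) d(A, B) and
   d(M, B) <= t d(A, B). Hence each refinement halves the bound on the distance
   of consecutive sets, and the levels move by at most a geometric series with
   first term of order m L h.

   The metric property follows once a simply different pair B, A has an average
   lying between B and A, with null boundary and with measure exactly
   t mu(A) + (1 - t) mu(B). For this the measure of the distance average has to
   depend continuously on its parameter g, i.e. the level set
   {g dS(., A) + (1 - g) dS(., B) = 0} must be null. It lies in
   {|g| d(., bd A) = |1 - g| d(., bd B)}, which is porous unless g = 1/2: a short
   move towards the boundary with the larger coefficient changes the difference
   of both sides linearly. At g = 1/2 this is the zero-measure condition,
   which always holds for empty B, where the level set is a bisector of a point and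
   a closed set, again porous. Porous sets are null by iterated subdivision of
   cubes. *)
Require Import Defs.
From HB Require Import structures.
From mathcomp Require Import all_boot all_order all_algebra.
From mathcomp Require Import all_classical all_reals all_analysis.
From mathcomp Require Import ring lra zify.
Import Order.TTheory GRing.Theory Num.Theory.
Import numFieldNormedType.Exports.
Set Implicit Arguments.
Unset Strict Implicit.
Unset Printing Implicit Defensive.
Local Open Scope classical_set_scope.
Local Open Scope ring_scope.

(** * Lebesgue outer measure *)

(* The dimension is [n.+1] throughout: in dimension 0 every box has volume 1, so
   that [leb set0 = +oo]. *)
Section LebesgueOuter.
Variables (R : realType) (n : nat).
Local Notation pt := 'rV[R]_n.+1.
Implicit Types (A B X : set pt) (a b p : pt).

(** Everything about averages is proved only up to null sets: [ci] alters a set along its boundary,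
    and a minimizer outside [0, 1] gives a set that need not contain the smaller set or lie in the
    larger one. If the zero-measure condition fails, the average is cut out by a neighbourhood of
    [B]; its boundary lies on the boundary of [A] and on a sphere around [B], and spheres of
    positive radius are porous without an exceptional ratio. Nested pairs reduce to simply different
    ones because the pieces of the difference are disjoint, so that bounds on what is added and what
    is missed can be summed. This needs null boundary for each piece, and nonempty interior too:
    with [B] empty, the center must have positive depth, or the bisector argument breaks down. No
    limit over infinitely many components occurs: only finitely many have measure at least [eps],
    and the merged rest is the difference minus a finite union. A general pair is handled by two
    nested pairs over the regular closed core of the intersection, which loses only a null set. *)

Lemma vol_ge0 a b : 0 <= vol a b.
Proof. by apply: prodr_ge0 => i _; rewrite le_max lexx orbT. Qed.

Lemma vol_eq0 a b i : b ord0 i <= a ord0 i -> vol a b = 0.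
Proof.
move=> ba; rewrite /vol (bigD1 i)//= (max_idPr _) ?mul0r//.
by rewrite subr_le0.
Qed.

Lemma leb_cover X (a b : nat -> pt) : X `<=` \bigcup_k box (a k) (b k) ->
  (leb X <= \sum_(k <oo) (vol (a k) (b k))%:E)%E.
Proof. by move=> Xab; apply: ereal_inf_lbound; exists a, b. Qed.

Lemma leb_ge0 X : (0 <= leb X)%E.
Proof.
apply: le_ereal_inf_tmp => _ [a [b [_ ->]]].
by apply: nneseries_ge0 => k _ _; rewrite lee_fin vol_ge0.
Qed.

Lemma le_leb : {homo (@leb R n.+1) : A B / A `<=` B >-> (A <= B)%E}.
Proof.
move=> A B AB; apply: ereal_inf_le_tmp => _ [a [b [Bab ->]]].
by exists a, b; split => //; exact: subset_trans Bab.
Qed.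

Lemma leb_box a b : (leb (box a b) <= (vol a b)%:E)%E.
Proof.
(* The cover is padded with the degenerate box at 0, of volume 0 because there is at least one
   coordinate. *)
pose A k := if k is 0%N then a else 0 : pt.
pose B k := if k is 0%N then b else 0 : pt.
apply: (@le_trans _ _ (\sum_(k <oo) (vol (A k) (B k))%:E)%E).
  by apply: leb_cover => p pab; exists 0%N.
rewrite nneseries_recl//; last by move=> k _; rewrite lee_fin vol_ge0.
rewrite eseries0 ?adde0// => -[//|k] _ _ /=.
by rewrite (@vol_eq0 _ _ ord0).
Qed.

Lemma leb_set0 : leb (set0 : set pt) = 0%E.
Proof.
apply/eqP; rewrite eq_le leb_ge0 andbT.
apply: (le_trans (@le_leb _ (box (0 : pt) 0) _)) => //.
by apply: (le_trans (leb_box _ _)); rewrite (@vol_eq0 _ _ ord0).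
Qed.

(** Each set gets a cover that is optimal up to a term of a geometric series. The doubly indexed
    boxes are enumerated along a bijection of [nat] with pairs, and the double sum is regrouped by
    rows. If one of the sets has infinite measure there is nothing to prove, and otherwise the
    infima are finite and can be approached. *)
Lemma leb_sigma_subadditive : sigma_subadditive (@leb R n.+1).
Proof.
move=> A; have [[i ioo]|] := pselect (exists i, leb (A i) = +oo%E).
  rewrite (eseries_pinfty _ _ ioo) ?leey// => k _.
  by rewrite -ltNye (lt_le_trans _ (leb_ge0 _)).
rewrite -forallNE => Aoo.
suff add2e (e : {posnum R}) :
    (leb (\bigcup_n A n) <= \sum_(i <oo) leb (A i) + e%:num%:E)%E.
  by apply/lee_addgt0Pr => _/posnumP[].
rewrite (le_trans _ (epsilon_trick _ _ _))//; last first.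
  by move=> k; exact: leb_ge0.
pose v (D : (nat -> pt) * (nat -> pt)) k := (vol (D.1 k) (D.2 k))%:E.
pose P k D := (A k `<=` \bigcup_j box (D.1 j) (D.2 j)) /\
  (\sum_(j <oo) v D j <= leb (A k) + (e%:num / (2 ^ k.+1)%:R)%:E)%E.
have [G PG] : {G : nat -> _ & forall k, P k (G k)}.
  apply: (@choice _ _ P) => k.
  have en1 : (0 < e%:num / (2 ^ k.+1)%:R)%R by [].
  have Af : leb (A k) \is a fin_num.
    by rewrite ge0_fin_numE ?leb_ge0// ltey; apply/eqP; exact: Aoo.
  have [_ [a [b [Aab ->]]] lt] := lb_ereal_inf_adherent en1 Af.
  by exists (a, b); split => //; exact/ltW.
have v_ge0 x : (0 <= v (G x.1) x.2)%E by rewrite lee_fin vol_ge0.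
apply: (@le_trans _ _ (\esum_(i in setT) v (G i.1) i.2)%E).
  apply: ereal_inf_lbound => /=.
  have /card_esym/ppcard_eqP[f] := card_nat2.
  exists (fun i => (G (f i).1).1 (f i).2), (fun i => (G (f i).1).2 (f i).2).
  split.
    move=> t [i _ /((PG i).1)[j _ Gt]].
    by exists (f^-1%FUN (i, j)) => //=; rewrite invK ?inE.
  rewrite -[RHS]/((\sum_(k <oo) ((fun i => v (G i.1) i.2) \o f) k)%E).
  rewrite -(esum_pred_image (fun i => v (G i.1) i.2) _ xpredT) ?[fun=> _]set_true//.
  by rewrite [X in image X]set_true image_eq.
rewrite (_ : esum _ _ = \sum_(i <oo) \sum_(j <oo ) v (G i) j)%E; last first.
  pose J : nat -> set (nat * nat) := fun i => [set (i, j) | j in setT].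
  rewrite (_ : setT = \bigcup_k J k); last first.
    by rewrite predeqE => -[a b]; split => // _; exists a => //; exists b.
  rewrite esum_bigcupT /=; last 2 first.
    - apply/trivIsetP => i j _ _ ij.
      rewrite predeqE => -[k m] /=; split => //= -[] [_] _ [<-{k} _].
      by move=> [m' _] [] /esym/eqP; rewrite (negbTE ij).
    - by move=> x; rewrite lee_fin vol_ge0.
  rewrite -(image_id [set: nat]) -fun_true esum_pred_image//; last first.
    by move=> k _; exact: esum_ge0.
  apply: eq_eseriesr => /= j _.
  rewrite -(esum_pred_image (fun i => v (G i.1) i.2) (pair j) predT)//=; last first.
    by move=> ? ? _ _; exact: (@can_inj _ _ _ snd).
    by move=> i _; rewrite lee_fin vol_ge0.
  by congr esum; rewrite predeqE => -[a b]; split; move=> [i _ <-]; exists i.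
apply: lee_lim.
- apply: is_cvg_nneseries => k *.
  by apply: nneseries_ge0 => m *; exact: (v_ge0 (k, m)).
- by apply: is_cvg_nneseries => k *; apply: adde_ge0 => //; exact: leb_ge0.
- by near=> k; apply: lee_sum => i _; exact: (PG i).2.
Unshelve. all: by end_near. Qed.

HB.instance Definition _ := isOuterMeasure.Build R pt (@leb R n.+1)
  leb_set0 leb_ge0 le_leb leb_sigma_subadditive.

(** Caratheodory measurability for this bundled form is [leb_measurable], so the sigma-algebra and
    the continuity of measures along monotone sequences become available. *)
Definition lebm : {outer_measure set pt -> \bar R} := @leb R n.+1.

Lemma leb_le0 A : (leb A <= 0)%E -> leb A = 0%E.
Proof. by move=> A0; apply/eqP; rewrite eq_le A0 leb_ge0. Qed.

Lemma sub_leb0 A B : A `<=` B -> leb B = 0%E -> leb A = 0%E.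
Proof. by move=> AB B0; apply: leb_le0; rewrite -B0 le_leb. Qed.

Lemma lebU A B : (leb (A `|` B) <= leb A + leb B)%E.
Proof. exact: (outer_measureU2 lebm). Qed.

Lemma leb0U A B : leb A = 0%E -> leb B = 0%E -> leb (A `|` B) = 0%E.
Proof.
by move=> A0 B0; apply: leb_le0; apply: (le_trans (lebU _ _)); rewrite A0 B0 adde0.
Qed.

Lemma leb0_bigcup (F : nat -> set pt) :
  (forall k, leb (F k) = 0%E) -> leb (\bigcup_k F k) = 0%E.
Proof.
move=> F0; apply: leb_le0; apply: (le_trans (leb_sigma_subadditive _)).
by rewrite eseries0// => k _ _; exact: F0.
Qed.

(** * Measurability of null sets, boxes, open and closed sets *)

Lemma leb_measurable_null A : leb A = 0%E -> leb_measurable A.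
Proof.
move=> A0; apply: (le_caratheodory_measurable (mu := lebm)) => X /=.
have -> : lebm (X `&` A) = 0%E.
  by apply: (@sub_leb0 _ A) => //; exact: subIsetr.
by rewrite add0e; apply: le_leb; exact: subIsetl.
Qed.

Definition upd p (i : 'I_n.+1) (c : R) : pt :=
  \row_j if j == i then c else p ord0 j.

(** A box is cut by the hyperplane with [i]-th coordinate [c]. If the hyperplane misses the box, one
    part is degenerate and the [Num.max] in [vol] makes its volume 0. *)
Lemma vol_split a b i c :
  vol a b = vol a (upd b i (Num.min (b ord0 i) c)) +
            vol (upd a i (Num.max (a ord0 i) c)) b.
Proof.
rewrite /vol (bigD1 i)//= [X in _ = X + _](bigD1 i)//= [X in _ = _ + X](bigD1 i)//=.
rewrite !mxE eqxx.
under [X in _ = _ * X + _]eq_bigr => j /negbTE ji do rewrite mxE ji.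
under [X in _ = _ + _ * X]eq_bigr => j /negbTE ji do rewrite mxE ji.
rewrite -mulrDl; congr (_ * _).
set x := a _ _; set y := b _ _.
have [ac|ca] := leP x c; have [bc|cb] := leP y c; rewrite !maxEle;
  do ?[case: leP => ?]; lra.
Qed.

(** Every covering box is cut in two, so a cover of [X] splits into covers of both parts at no cost.
    The pieces are closed boxes that share a face, so it does not matter which part of the
    hyperplane belongs to [H]. *)
Lemma leb_measurable_halfspace (i : 'I_n.+1) (c : R) (H : set pt) :
  [set p : pt | p ord0 i < c] `<=` H -> H `<=` [set p | p ord0 i <= c] -> leb_measurable H.
Proof.
move=> cH Hc; apply: (le_caratheodory_measurable (mu := lebm)) => X.
apply: le_ereal_inf_tmp => _ [a [b [Xab ->]]].
pose b' k := upd (b k) i (Num.min (b k ord0 i) c).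
pose a' k := upd (a k) i (Num.max (a k ord0 i) c).
under eq_eseriesr do rewrite (@vol_split _ _ i c) EFinD.
rewrite nneseriesD//; last 2 first.
- by move=> *; rewrite lee_fin vol_ge0.
- by move=> *; rewrite lee_fin vol_ge0.
apply: leeD; apply: leb_cover.
- move=> p [/Xab[k _ pab] Hp]; exists k => // j; rewrite mxE.
  case: ifP => [/eqP ->|_]; last exact: pab.
  by have /andP[-> pb] := pab i; rewrite le_min pb (Hc _ Hp).
- move=> p [/Xab[k _ pab] Hp]; exists k => // j; rewrite mxE.
  case: ifP => [/eqP ->|_]; last exact: pab.
  have /andP[pa ->] := pab i; rewrite ge_max pa andbT/= leNgt.
  by apply/negP => pc; apply: Hp; exact: cH.
Qed.

Lemma leb_measurable_box a b : leb_measurable (box a b).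
Proof.
rewrite (_ : box a b = \bigcap_(i in [set: 'I_n.+1])
  ([set p : pt | p ord0 i <= b ord0 i] `&` ~` [set p | p ord0 i < a ord0 i])).
  apply: (@fin_bigcap_measurable _ (caratheodory_type lebm)) => // i _.
  apply: caratheodory_measurable_setI.
    by apply: (@leb_measurable_halfspace i (b ord0 i)) => p //= /ltW.
  apply: caratheodory_measurable_setC.
  by apply: (@leb_measurable_halfspace i (a ord0 i)) => p //= /ltW.
apply/seteqP; split => p.
  move=> pab i/= _; have /andP[pa pb] := pab i.
  by split => //=; apply/negP; rewrite -leNgt.
by move=> pab i; have [/= -> /negP] := pab i I; rewrite -leNgt => ->.
Qed.

Lemma nbhs_boxP p A : nbhs p A <->
  exists2 e : R, 0 < e & forall q : pt, (forall i, `|p ord0 i - q ord0 i| < e) -> A q.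
Proof.
split.
  move=> /nbhs_ballP[e e0 eA]; exists e => // q pq; apply: eA.
  by split => // i j; rewrite !ord1; exact: pq.
move=> [e e0 eA]; apply/nbhs_ballP; exists e => // q [_ pq].
by apply: eA => i; exact: pq.
Qed.

(** An open set is the union of the boxes with rational corners that it contains, and there are
    countably many of these. *)
Lemma leb_measurable_open A : open A -> leb_measurable A.
Proof.
move=> oA.
pose rv (q : 'rV[rat]_n.+1) : pt := map_mx (ratr : rat -> R) q.
pose F (q : 'rV[rat]_n.+1 * 'rV[rat]_n.+1) :=
  if pselect (box (rv q.1) (rv q.2) `<=` A) then box (rv q.1) (rv q.2) else set0.
have -> : A = \bigcup_q F q.
  apply/seteqP; split=> [p Ap|p [q _]]; last first.
    by rewrite /F; case: pselect => // sub /sub.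
  have /nbhs_boxP[e e0 eA] : nbhs p A by apply: open_nbhs_nbhs.
  have lo (i : 'I_n.+1) : exists q : rat,
      ratr q \in `]p ord0 i - e, p ord0 i[.
    by have /rat_in_itvoo[] : p ord0 i - e < p ord0 i; [lra|move=> q; exists q].
  have hi (i : 'I_n.+1) : exists q : rat,
      ratr q \in `]p ord0 i, p ord0 i + e[.
    by have /rat_in_itvoo[] : p ord0 i < p ord0 i + e; [lra|move=> q; exists q].
  move/choice: lo => [f fP]; move/choice: hi => [g gP].
  exists (\row_i f i, \row_i g i) => //; rewrite /F.
  case: pselect => /= [_|[]].
    move=> i; rewrite !mxE; move: (fP i) (gP i); rewrite !in_itv/=.
    by move=> /andP[_ /ltW ->] /andP[/ltW].
  move=> x xb; apply: eA => i; have := xb i; rewrite !mxE.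
  move: (fP i) (gP i); rewrite !in_itv/= ltr_norml.
  by move=> /andP[? ?] /andP[? ?] /andP[? ?]; apply/andP; split; lra.
suff : measurable (\bigcup_q F q : set (caratheodory_type lebm)) by [].
apply: countable_bigcupT_measurable => [|q]; first exact: countableP.
rewrite /F; case: pselect => /= sub; last exact: measurable0.
exact: leb_measurable_box.
Qed.

Lemma leb_measurable_setC A : leb_measurable A -> leb_measurable (~` A).
Proof. exact: (@caratheodory_measurable_setC _ _ lebm). Qed.

Lemma leb_measurable_setU A B : leb_measurable A -> leb_measurable B -> leb_measurable (A `|` B).
Proof. exact: (@caratheodory_measurable_setU _ _ lebm). Qed.

Lemma leb_measurable_setI A B : leb_measurable A -> leb_measurable B -> leb_measurable (A `&` B).
Proof. exact: (@caratheodory_measurable_setI _ _ lebm). Qed.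

Lemma leb_measurable_closed A : closed A -> leb_measurable A.
Proof. by move=> cA; rewrite -(setCK A); apply/leb_measurable_setC/leb_measurable_open/closed_openC. Qed.

End LebesgueOuter.

(** * Signed distance *)

Section Distance.
Variables (R : realType) (n : nat).
Local Notation edist := Defs.edist.
Local Notation pt := 'rV[R]_n.+1.
Implicit Types (A B E : set pt) (p q y z : pt).

(** * The Euclidean norm and its topology *)

Lemma enorm_sqr p : enorm p ^+ 2 = \sum_i p ord0 i ^+ 2.
Proof. by rewrite sqr_sqrtr// sumr_ge0// => i _; exact: sqr_ge0. Qed.

Lemma enorm_ge0 p : 0 <= enorm p.
Proof. exact: sqrtr_ge0. Qed.

Lemma enorm_le p c : 0 <= c -> \sum_i p ord0 i ^+ 2 <= c ^+ 2 -> enorm p <= c.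
Proof.
by move=> c0 pc; rewrite -(ler_pXn2r (ltn0Sn 1)) ?nnegrE ?enorm_ge0// enorm_sqr.
Qed.

Lemma enormZ c p : enorm (c *: p) = `|c| * enorm p.
Proof.
rewrite /enorm -sqrtr_sqr -sqrtrM ?sqr_ge0//; congr Num.sqrt.
by rewrite mulr_sumr; apply: eq_bigr => i _; rewrite mxE exprMn.
Qed.

Lemma enormN p : enorm (- p) = enorm p.
Proof. by rewrite -scaleN1r enormZ normrN1 mul1r. Qed.

Lemma enorm0 : enorm (0 : pt) = 0.
Proof. by rewrite -(scale0r (0 : pt)) enormZ normr0 mul0r. Qed.

Lemma enormB p q : enorm (p - q) = enorm (q - p).
Proof. by rewrite -enormN opprB. Qed.

Lemma coord_le_enorm p i : `|p ord0 i| <= enorm p.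
Proof.
rewrite -sqrtr_sqr; apply: ler_wsqrtr.
rewrite (bigD1 i)//= lerDl; apply: sumr_ge0 => j _; exact: sqr_ge0.
Qed.

Lemma enorm_le_coord p e : 0 <= e -> (forall i, `|p ord0 i| <= e) ->
  enorm p <= n.+1%:R * e.
Proof.
move=> e0 pe; apply: enorm_le; first exact: mulr_ge0.
apply: (@le_trans _ _ (\sum_(i < n.+1) e ^+ 2)).
  by apply: ler_sum => i _; rewrite -real_normK ?num_real// lerXn2r ?nnegrE.
rewrite sumr_const card_ord exprMn -(mulr_natl (e ^+ 2)) ler_wpM2r ?sqr_ge0//.
by rewrite expr2 ler_peMl// ler1n.
Qed.

Lemma enorm_eq0 p : enorm p = 0 -> p = 0.
Proof.
move=> p0; apply/rowP => i; rewrite mxE; apply/eqP.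
by rewrite -normr_le0 -p0 coord_le_enorm.
Qed.

Lemma cauchy_schwarz p q :
  \sum_i p ord0 i * q ord0 i <= enorm p * enorm q.
Proof.
move PE : (\sum_i _) => P.
have [q0|q0] := eqVneq (enorm q) 0.
  by rewrite q0 mulr0 -PE big1// => i _; rewrite (enorm_eq0 q0) mxE mulr0.
have qp : 0 < enorm q by rewrite lt_def q0 enorm_ge0.
(* This is the squared norm of the component of [p] orthogonal to [q], scaled by [enorm q ^+ 4] to
   avoid division. *)
have : 0 <= \sum_i (enorm q ^+ 2 * p ord0 i - P * q ord0 i) ^+ 2.
  by apply: sumr_ge0 => i _; exact: sqr_ge0.
have -> : \sum_i (enorm q ^+ 2 * p ord0 i - P * q ord0 i) ^+ 2 =
    enorm q ^+ 2 * ((enorm p * enorm q) ^+ 2 - P ^+ 2).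
  transitivity (enorm q ^+ 4 * (\sum_i p ord0 i ^+ 2)
    - 2 * enorm q ^+ 2 * P * (\sum_i p ord0 i * q ord0 i)
    + P ^+ 2 * (\sum_i q ord0 i ^+ 2)); last first.
    by rewrite -!enorm_sqr PE; ring.
  rewrite !mulr_sumr -sumrN -!big_split/=; apply: eq_bigr => i _; ring.
rewrite pmulr_rge0 ?exprn_gt0// subr_ge0 => H.
have [P0|P0] := leP P 0.
  by apply: (le_trans P0); rewrite mulr_ge0 ?enorm_ge0.
rewrite -(ler_pXn2r (ltn0Sn 1))// ?nnegrE ?mulr_ge0 ?enorm_ge0//.
exact: ltW.
Qed.

Lemma enormD p q : enorm (p + q) <= enorm p + enorm q.
Proof.
apply: enorm_le; first by rewrite addr_ge0 ?enorm_ge0.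
have -> : \sum_i (p + q) ord0 i ^+ 2 =
    enorm p ^+ 2 + 2 * (\sum_i p ord0 i * q ord0 i) + enorm q ^+ 2.
  rewrite !enorm_sqr mulr_sumr -!big_split/=; apply: eq_bigr => i _.
  by rewrite mxE; ring.
have := cauchy_schwarz p q; nra.
Qed.

Lemma enorm_tri q p y : enorm (p - y) <= enorm (p - q) + enorm (q - y).
Proof.
have -> : p - y = (p - q) + (q - y) by rewrite addrA subrK.
exact: enormD.
Qed.

Lemma nbhs_enormP p A : nbhs p A <->
  exists2 e : R, 0 < e & forall q, enorm (p - q) < e -> A q.
Proof.
split=> [/nbhs_boxP[e e0 eA]|[e e0 eA]].
  exists e => // q pq; apply: eA => i; apply: le_lt_trans pq.
  by have := coord_le_enorm (p - q) i; rewrite !mxE.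
(* The Euclidean norm is at most [n.+1] times the sup norm; dividing by [n.+2] keeps the inequality
   strict. *)
apply/nbhs_boxP; exists (e / n.+2%:R); first by rewrite divr_gt0.
move=> q pq; apply: eA.
apply: (@le_lt_trans _ _ (n.+1%:R * (e / n.+2%:R))).
  apply: enorm_le_coord; first by rewrite divr_ge0// ltW.
  by move=> i; rewrite !mxE; exact/ltW.
by rewrite mulrCA gtr_pMr// ltr_pdivrMr// mul1r ltr_nat.
Qed.

Lemma closure_enormP p A : closure A p <->
  forall e : R, 0 < e -> exists2 q, A q & enorm (p - q) < e.
Proof.
split=> [cA e e0|H U /nbhs_enormP[e e0 eU]].
  have [|q [Aq pq]] := cA [set q | enorm (p - q) < e]; last by exists q.
  by apply/nbhs_enormP; exists e.
by have [q Aq pq] := H e e0; exists q; split => //; exact: eU.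
Qed.

(** * Distance to a set *)

Lemma edist_has_inf p E : E !=set0 -> has_inf [set enorm (p - e) | e in E].
Proof.
move=> [e Ee]; split; first by exists (enorm (p - e)), e.
by exists 0 => _ [x _ <-]; exact: enorm_ge0.
Qed.

Lemma edist_le p E e : E e -> edist p E <= enorm (p - e).
Proof.
move=> Ee; apply: ge_inf; last by exists e.
by exists 0 => _ [x _ <-]; exact: enorm_ge0.
Qed.

Lemma edist_ge p E c : E !=set0 -> (forall e, E e -> c <= enorm (p - e)) ->
  c <= edist p E.
Proof.
move=> [e Ee] H; apply: lb_le_inf; first by exists (enorm (p - e)), e.
by move=> _ [x Ex <-]; exact: H.
Qed.

Lemma edist_ge0 p E : 0 <= edist p E.
Proof.
have [->|/set0P E0] := eqVneq E set0; last by apply: edist_ge => // e _; exact: enorm_ge0.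
by rewrite /edist image_set0 inf0.
Qed.

Lemma edist_adherent p E c : E !=set0 -> edist p E < c ->
  exists2 e, E e & enorm (p - e) < c.
Proof.
move=> E0 c0; have /inf_adherent : 0 < c - edist p E by rewrite subr_gt0.
move=> /(_ _ (edist_has_inf p E0))[_ [e Ee <-]].
by rewrite -/(edist p E) [ltRHS]addrC subrK; exists e.
Qed.

Lemma edist_lip p q E : E !=set0 -> edist p E <= edist q E + enorm (p - q).
Proof.
move=> E0; rewrite -lerBlDr; apply: edist_ge => // e Ee; rewrite lerBlDl.
exact: (le_trans (edist_le _ Ee) (enorm_tri _ _ _)).
Qed.

Lemma edist_lip_abs p q E : E !=set0 -> `|edist p E - edist q E| <= enorm (p - q).
Proof.
move=> E0; have := edist_lip p q E0; have := edist_lip q p E0.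
rewrite (enormB q p) ler_norml => *; apply/andP; split; lra.
Qed.

Lemma edist_closure p E : closure E p -> edist p E = 0.
Proof.
move=> cE; apply/eqP; rewrite eq_le edist_ge0 andbT.
apply/ler_addgt0Pr => e e0; rewrite add0r.
move/closure_enormP : cE => /(_ e e0)[q Eq pq].
exact: (le_trans (edist_le _ Eq) (ltW pq)).
Qed.

Lemma edist_eq0 p E : E !=set0 -> edist p E <= 0 -> closure E p.
Proof.
move=> E0 pE; apply/closure_enormP => e e0.
by apply: edist_adherent => //; exact: le_lt_trans e0.
Qed.

(** The supremum of the parameters whose points on the segment lie in [A] gives such a [z]. All
    comparisons of signed distances below rest on these crossings. *)
Lemma segment_bdry A p y : A p -> ~ A y ->
  exists2 z, bdry A z & enorm (p - z) + enorm (z - y) = enorm (p - y).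
Proof.
move=> Ap Ay; pose g (t : R) := p + t *: (y - p).
have g0 : g 0 = p by rewrite /g scale0r addr0.
have g1 : g 1 = y by rewrite /g scale1r addrC subrK.
have gE s t : enorm (g s - g t) = `|s - t| * enorm (p - y).
  rewrite (enormB p y) -enormZ scalerBl /g opprD addrACA subrr add0r.
  by [].
pose S := [set t : R | 0 <= t <= 1 /\ A (g t)].
have S0 : S 0 by rewrite /S/= g0 lexx ler01.
have S1 : ubound S 1 by move=> t [/andP[]].
have hS : has_sup S by split; [exists 0|exists 1].
have t0 : 0 <= sup S by apply: ub_le_sup => //; exists 1.
have t1 : sup S <= 1 by apply: ge_sup => //; exists 0.
have py : 0 < enorm (p - y).
  rewrite lt_def enorm_ge0 andbT; apply/eqP => /enorm_eq0/eqP.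
  by rewrite subr_eq0 => /eqP pE; apply: Ay; rewrite -pE.
exists (g (sup S)); last first.
  have := gE 0 (sup S); have := gE (sup S) 1; rewrite g0 g1 => -> ->.
  rewrite -mulrDl sub0r normrN distrC !ger0_norm ?subr_ge0//.
  by rewrite addrC subrK mul1r.
split.
  apply/closure_enormP => e e0.
  have /sup_adherent/(_ hS)[t St tS] : 0 < e / enorm (p - y) by rewrite divr_gt0.
  exists (g t); first by case: St.
  rewrite gE -ltr_pdivlMr// ger0_norm ?subr_ge0; last exact: ub_le_sup hS.2 _ St.
  by lra.
(* If the point at [sup S] were interior to [A], a slightly larger parameter would still belong to
   [S]. *)
move=> /nbhs_enormP[e e0 eA].
move: t1; rewrite le_eqVlt => /predU1P[tE|t1].
  by apply: Ay; rewrite -g1 -tE; apply: eA; rewrite subrr enorm0.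
pose d := Num.min (1 - sup S) (e / 2 / enorm (p - y)).
have d0 : 0 < d by rewrite lt_min subr_gt0 t1 !divr_gt0.
have d1 : d <= 1 - sup S by rewrite ge_min lexx.
have d2 : d <= e / 2 / enorm (p - y) by rewrite ge_min lexx orbT.
have : sup S + d <= sup S.
  apply: ub_le_sup; first by exists 1.
  split; first by apply/andP; split; lra.
  apply: eA; rewrite gE opprD addrA subrr add0r normrN gtr0_norm//.
  by apply: (@le_lt_trans _ _ (e / 2)); [rewrite -ler_pdivlMr|lra].
by lra.
Qed.

Lemma closed_bdry A : closed (bdry A).
Proof.
rewrite /bdry setDE; apply: closedI; first exact: closed_closure.
by apply: open_closedC; exact: open_interior.
Qed.

Lemma bdry_setC A z : bdry A z -> closure (~` A) z.
Proof. by move=> [_ nz]; rewrite closure_setC. Qed.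

(** Such a set has a nonempty boundary. For an empty one [edist] would be the default value 0 of the
    infimum. *)
Definition proper_set A := A !=set0 /\ (~` A) !=set0.

Lemma bdry_nonempty A : proper_set A -> bdry A !=set0.
Proof. by move=> [[p Ap] [y Ay]]; have [z Az _] := segment_bdry Ap Ay; exists z. Qed.

Lemma bounded_proper A : A !=set0 -> bounded_pt A -> proper_set A.
Proof.
move=> A0 [M AM]; split => //; exists (const_mx (`|M| + 1)) => /AM.
have := coord_le_enorm (const_mx (`|M| + 1) : pt) ord0; rewrite mxE.
have := ler_norm (`|M| + 1); have := ler_norm M; lra.
Qed.

Lemma dS_in A p : A p -> dS p A = edist p (bdry A).
Proof. by rewrite /dS; case: asboolP. Qed.

Lemma dS_out A p : ~ A p -> dS p A = - edist p (bdry A).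
Proof. by rewrite /dS; case: asboolP. Qed.

Lemma dS_abs A p : `|dS p A| = edist p (bdry A).
Proof.
by have H := edist_ge0 p (bdry A); rewrite /dS; case: asboolP => _;
  rewrite ?(normrN (edist _ _)) ger0_norm.
Qed.

(** For points on different sides the two distances add up, and their sum is at most the length of
    the segment because it crosses the boundary. *)
Lemma dS_lip A p q : proper_set A -> dS p A <= dS q A + enorm (p - q).
Proof.
move=> pA; have b0 := bdry_nonempty pA.
have [Ap|Ap] := pselect (A p); have [Aq|Aq] := pselect (A q).
- by rewrite !dS_in//; exact: edist_lip.
- rewrite dS_in// dS_out//; have [z bz <-] := segment_bdry Ap Aq.
  have := edist_le p bz; have := edist_le q bz; rewrite (enormB q z); lra.
- rewrite dS_out// dS_in//; have := edist_ge0 p (bdry A).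
  have := edist_ge0 q (bdry A); have := enorm_ge0 (p - q); lra.
- rewrite !dS_out//; have := edist_lip q p b0; rewrite (enormB q p); lra.
Qed.

(** Outside [A], a boundary point of [B] is a limit of points of [A], and the segments from these to
    [p] cross the boundary of [A] first. Inside [B], a boundary point of [A] is a limit of points
    outside [B], and the segments cross the boundary of [B]. *)
Lemma dS_mono A B p : proper_set A -> proper_set B -> B `<=` A -> dS p B <= dS p A.
Proof.
move=> pA pB BA.
have [Ap|Ap] := pselect (A p); last first.
  rewrite (dS_out Ap) dS_out; last by move/BA.
  rewrite lerN2; apply: edist_ge; first exact: bdry_nonempty.
  move=> z [/closure_enormP cz _]; apply/ler_addgt0Pr => e e0.
  have [y By zy] := cz e e0; have [w bw wE] := segment_bdry (BA _ By) Ap.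
  have := edist_le p bw; have := enorm_tri z p y; have := enorm_ge0 (y - w).
  by rewrite (enormB p w) -(enormB p) -(enormB y) in wE *; lra.
rewrite (dS_in Ap); have [Bp|Bp] := pselect (B p); last first.
  by rewrite dS_out//; have := edist_ge0 p (bdry A); have := edist_ge0 p (bdry B); lra.
rewrite dS_in//; apply: edist_ge; first exact: bdry_nonempty.
move=> z /bdry_setC/closure_enormP cz; apply/ler_addgt0Pr => e e0.
have [y Ay zy] := cz e e0.
have [w bw wE] := segment_bdry Bp (fun By => Ay (BA _ By)).
by have := edist_le p bw; have := enorm_tri z p y; have := enorm_ge0 (w - y); lra.
Qed.

Lemma dS_ge0_closure A p : proper_set A -> 0 <= dS p A <-> closure A p.
Proof.
move=> pA; have b0 := bdry_nonempty pA.
have [Ap|Ap] := pselect (A p).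
  by rewrite dS_in// edist_ge0; split => // _; exact: subset_closure.
rewrite dS_out// oppr_ge0; split=> [|cA].
  move/(edist_eq0 b0); rewrite -(closure_id _).1; last exact: closed_bdry.
  by case.
rewrite edist_closure//; apply: subset_closure; split => // iA.
by apply: Ap; exact: interior_subset iA.
Qed.

Lemma dS_gt0_interior A p : proper_set A -> 0 < dS p A <-> interior A p.
Proof.
move=> pA; have b0 := bdry_nonempty pA; split => [dp|iA].
  have cA : closure A p by apply/dS_ge0_closure => //; exact: ltW.
  apply: contrapT => iA; move: dp.
  by rewrite -[_ < _]/(0 < _) => /lt0r_neq0; rewrite -normr_eq0 dS_abs edist_closure ?eqxx//;
    apply: subset_closure.
rewrite lt_def dS_in ?edist_ge0 ?andbT; last exact: interior_subset iA.
apply/eqP => /eqP; rewrite eq_le => /andP[/(edist_eq0 b0) + _].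
by rewrite -(closure_id _).1; [case|exact: closed_bdry].
Qed.

Lemma dS_eq0_bdry A p : proper_set A -> dS p A = 0 -> bdry A p.
Proof.
move=> pA d0; split; first by apply/dS_ge0_closure; rewrite ?d0.
by move/(dS_gt0_interior _ pA); rewrite d0 ltxx.
Qed.

End Distance.

(** * Porous sets and level sets of distance functions *)

Section Porosity.
Variables (R : realType) (n : nat).
Local Notation edist := Defs.edist.
Local Notation pt := 'rV[R]_n.+1.
Implicit Types (A B E Z K : set pt) (a p q y z : pt).

Lemma leb_fin_cover (I : finType) (P : pred I) (F : I -> set pt) X :
  (forall p, X p -> exists2 i, P i & F i p) ->
  (leb X <= \sum_(i | P i) leb (F i))%E.
Proof.
move=> XF; apply: (@le_trans _ _ (leb (\big[setU/set0]_(i | P i) F i))).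
  by apply: le_leb => p /XF[i Pi Fip]; rewrite (bigD1 i)//=; left.
elim/big_ind2 : _ => [|A x B y' Ax Bx|//]; first by rewrite leb_set0.
exact: le_trans (lebU _ _) (leeD Ax Bx).
Qed.

Definition cube a (s : R) : set pt := box a (a + const_mx s).

Lemma leb_cube a s : 0 <= s -> (leb (cube a s) <= (s ^+ n.+1)%:E)%E.
Proof.
move=> s0; apply: (le_trans (leb_box _ _)); rewrite lee_fin /vol.
rewrite (eq_bigr (fun=> s)) ?prodr_const ?card_ord// => i _.
by rewrite !mxE (_ : _ - _ = s); [exact/max_idPl|ring].
Qed.

Lemma cubeP a s p : cube a s p <-> forall i, 0 <= p ord0 i - a ord0 i <= s.
Proof.
by split=> H i; move: (H i); rewrite !mxE => /andP[? ?]; apply/andP; split; lra.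
Qed.

Definition subcorner a (w : R) k (f : {ffun 'I_n.+1 -> 'I_k}) : pt :=
  a + \row_i (w * (f i)%:R).

Lemma grid_coord (w x : R) k : 0 < w -> (0 < k)%N -> 0 <= x <= k%:R * w ->
  exists j : 'I_k, 0 <= x - w * j%:R <= w.
Proof.
move=> w0 k0 /andP[x0 xk].
have ex : exists j, x <= j.+1%:R * w by exists k.-1; rewrite prednK.
have [j xj jmin] := ex_minnP ex.
have jk : (j < k)%N.
  by rewrite -(prednK k0) ltnS; apply: jmin; rewrite prednK.
exists (Ordinal jk) => /=; move: xj; rewrite -natr1 => xj.
apply/andP; split; last by lra.
case: j jmin {jk xj} => [|j] jmin; first by rewrite mulr0 subr0.
rewrite subr_ge0 mulrC leNgt; apply/negP => /ltW/jmin.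
by rewrite ltnn.
Qed.

Lemma cube_grid a s k q : 0 < s -> (0 < k)%N -> cube a s q ->
  exists f : {ffun 'I_n.+1 -> 'I_k}, cube (subcorner a (s / k%:R) f) (s / k%:R) q.
Proof.
move=> s0 k0 /cubeP qa; have kR : 0 < k%:R :> R by rewrite ltr0n.
have w0 : 0 < s / k%:R by rewrite divr_gt0.
have /choice[f fP] (i : 'I_n.+1) : exists j : 'I_k,
    0 <= (q ord0 i - a ord0 i) - s / k%:R * j%:R <= s / k%:R.
  by apply: grid_coord => //; rewrite mulrC divfK ?gt_eqF.
exists [ffun i => f i]; apply/cubeP => i; move: (fP i).
by rewrite !mxE ffunE opprD addrA.
Qed.

(** Uniform porosity: one ratio [kappa] serves all points of [Z] and all scales up to [r]. *)
Definition porous Z (kappa r : R) := forall p, Z p -> forall s, 0 < s <= r ->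
  exists2 p', enorm (p - p') <= s & forall q, enorm (p' - q) <= kappa * s -> ~ Z q.

(* The hole has to fit inside the cube, so it is looked for around a point of
   [Z] in the central subcube. *)
Lemma porous_missed_subcube Z kappa r : 0 < kappa -> 0 < r -> porous Z kappa r ->
  exists2 k, (1 < k)%N & forall a s, 0 < s <= r ->
  exists f : {ffun 'I_n.+1 -> 'I_k}, forall q,
    cube (subcorner a (s / k%:R) f) (s / k%:R) q -> ~ Z q.
Proof.
move=> k0 r0 pZ.
(* Subcubes of side [s / k] have diameter at most [n.+1%:R * (s / k)], which has to fit into the
   hole of radius [kappa * (s / 4)]. *)
have [J JP] : exists J : nat, n.+1%:R * 4 / kappa < J%:R.
  have := archi_boundP (x := n.+1%:R * 4 / kappa).
  by rewrite divr_ge0 ?mulr_ge0 ?(ltW k0)// => /(_ isT); exists (Num.bound (n.+1%:R * 4 / kappa)).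
(* With [k] even, the subcube of index [J.+2] starts at the middle of the cube; its side is at most
   [s / 4], so a displacement by [s / 4] stays inside the cube. *)
pose k := (2 * J.+2)%N.
have kR : k%:R = 2 * J%:R + 4 :> R by rewrite natrM -addn2 natrD; lra.
exists k => // a s /andP[s0 sr].
have kpos : 0 < k%:R :> R by rewrite ltr0n.
have w0 : 0 < s / k%:R by rewrite divr_gt0.
apply: contrapT => /forallNP H.
have {}H (f : {ffun 'I_n.+1 -> 'I_k}) : exists2 q,
    cube (subcorner a (s / k%:R) f) (s / k%:R) q & Z q.
  by apply: contrapT => /forall2NP Hf; apply: (H f) => q; case: (Hf q).
have Jk : (J.+2 < k)%N by rewrite /k mul2n -addnn -[ltnLHS]addn0 ltn_add2l.
have [p /cubeP pc Zp] := H [ffun=> Ordinal Jk].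
have s4 : 0 < s / 4 <= r by apply/andP; split; lra.
have [p' pp' p'Z] := pZ p Zp _ s4.
have ws : s / k%:R * (2 * J%:R + 4) = s by rewrite -kR divfK ?gt_eqF.
have J0 : 0 <= J%:R :> R by [].
have p'c : cube a s p'.
  apply/cubeP => i; have := pc i; rewrite !mxE ffunE/=.
  have := le_trans (coord_le_enorm _ i) pp'; rewrite !mxE ler_norml.
  rewrite -[J.+2]addn2 natrD => /andP[h1 h2] /andP[h3 h4].
  have : 0 <= s / k%:R * J%:R by rewrite mulr_ge0 // ltW.
  by move: ws h3 h4; move: (s / k%:R) w0 => w w0 ws h3 h4 wJ; apply/andP; split; lra.
have [f /cubeP fp'] := cube_grid s0 (isT : (0 < k)%N) p'c.
have [q /cubeP qf Zq] := H f.
apply: (p'Z q) => //.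
apply: (@le_trans _ _ (n.+1%:R * (s / k%:R))).
  apply: enorm_le_coord; first exact: ltW.
  move=> i; move: (fp' i) (qf i); rewrite !mxE ler_norml.
  by move=> /andP[? ?] /andP[? ?]; apply/andP; split; lra.
rewrite mulrA ler_pdivrMr// kR.
move: JP; rewrite ltr_pdivrMr// -(ltr_pM2l s0) => JP.
have ks : 0 < kappa * s by rewrite mulr_gt0.
have ns : 0 <= n.+1%:R * s by rewrite mulr_ge0 ?(ltW s0).
have Jks : 0 <= J%:R * (kappa * s) by rewrite mulr_ge0 ?(ltW ks).
lra.
Qed.

Lemma porous_leb0 Z kappa r : 0 < kappa -> 0 < r -> porous Z kappa r ->
  bounded_pt Z -> leb Z = 0%E.
Proof.
move=> kap0 r0 pZ [M ZM].
have [k k1 kP] := porous_missed_subcube kap0 r0 pZ.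
have k0 : (0 < k)%N by exact: ltnW.
have kR : 0 < k%:R :> R by rewrite ltr0n.
(* One of the [k ^ n.+1] subcubes misses [Z]; [c] is the fraction of volume that remains after one
   subdivision. *)
pose c : R := (k ^ n.+1).-1%:R / (k ^ n.+1)%:R.
have kn : (0 < k ^ n.+1)%N by rewrite expn_gt0 k0.
have c01 : 0 <= c < 1.
  rewrite /c divr_ge0//= ltr_pdivrMr ?ltr0n// mul1r ltr_nat.
  by rewrite -{2}(prednK kn).
have step j : forall a s, 0 < s <= r ->
    (leb (Z `&` cube a s) <= (c ^+ j * s ^+ n.+1)%:E)%E.
  elim: j => [|j IH] a s /andP[s0 sr].
    rewrite expr0 mul1r; apply: le_trans (leb_cube _ (ltW s0)).
    by apply: le_leb; exact: subIsetr.
  have [f0 f0P] := kP a s (introT andP (conj s0 sr)).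
  apply: (le_trans (@leb_fin_cover _ (fun f : {ffun 'I_n.+1 -> 'I_k} => f != f0)
    (fun f => Z `&` cube (subcorner a (s / k%:R) f) (s / k%:R)) _ _)).
    move=> q [Zq qa]; have [f fq] := cube_grid s0 k0 qa.
    by exists f => //; apply/eqP => ff; apply: (f0P q) => //; rewrite -ff.
  apply: (@le_trans _ _ (\sum_(f : {ffun 'I_n.+1 -> 'I_k} | f != f0)
      (c ^+ j * (s / k%:R) ^+ n.+1)%:E)%E).
    apply: lee_sum => f _; apply: IH; rewrite divr_gt0//=.
    by rewrite ler_pdivrMr// (le_trans sr)// ler_peMr ?(ltW r0)// ler1n.
  rewrite sumEFin lee_fin sumr_const cardC1 card_ffun !card_ord.
  rewrite -[leLHS]mulr_natl -subn1 natrB// (exprS c).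
  have -> : (s / k%:R) ^+ n.+1 = s ^+ n.+1 / (k ^ n.+1)%:R.
    by rewrite exprMn exprVn natrX.
  move: (c ^+ j) => C; rewrite /c -subn1 natrB//.
  set x := (k ^ _)%:R; set y := s ^+ _.
  by rewrite le_eqVlt; apply/orP; left; apply/eqP; ring.
have null a s : 0 < s <= r -> leb (Z `&` cube a s) = 0%E.
  move=> sr; apply/eqP; rewrite eq_le leb_ge0 andbT.
  have fl : (leb (Z `&` cube a s) < +oo)%E.
    by apply: le_lt_trans (step 0%N a s sr) _; rewrite ltry.
  rewrite -(fineK (x := leb (Z `&` cube a s))) ?ge0_fin_numE ?leb_ge0//.
  rewrite lee_fin; apply/ler_addgt0Pr => e e0; rewrite add0r.
  have s0 : 0 < s ^+ n.+1 by apply: exprn_gt0; case/andP: sr.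
  have /(cvgr0Pnorm_lt (fun j => c ^+ j)) : (fun j => c ^+ j) @ \oo --> 0.
    by apply: cvg_expr; case/andP: c01 => c0 c1; rewrite ger0_norm.
  move=> /(_ (e / s ^+ n.+1)); rewrite divr_gt0// => /(_ isT)[j _ /(_ j (leqnn j))].
  rewrite ger0_norm ?exprn_ge0//; last by case/andP: c01.
  rewrite ltr_pdivlMr// => /ltW; apply: le_trans.
  rewrite -lee_fin fineK ?ge0_fin_numE ?leb_ge0//; exact: step.
(* The cube of side [S] at [a] contains [Z], and it is cut into cubes small enough for the scale
   bound [r]. The summand 1 keeps [S] positive. *)
pose S := 2 * `|M| + 1; pose a : pt := const_mx (- `|M|).
have S0 : 0 < S by rewrite /S; have := normr_ge0 M; lra.
have [N0 SN] : exists N0 : nat, S / r < N0.+1%:R.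
  exists (Num.bound (S / r)); apply: (lt_trans (archi_boundP _)).
    by rewrite divr_ge0 ?ltW.
  by rewrite ltr_nat.
apply: leb_le0; apply: (le_trans (@leb_fin_cover _ xpredT
    (fun f : {ffun 'I_n.+1 -> 'I_N0.+1} =>
    Z `&` cube (subcorner a (S / N0.+1%:R) f) (S / N0.+1%:R)) _ _)).
  move=> q Zq; have [//||f fq] := @cube_grid a S N0.+1 q S0.
    apply/cubeP => i; rewrite !mxE; have := coord_le_enorm q i.
    have := ZM q Zq; have := ler_norm M; rewrite ler_norml /S => h1 h2 /andP[h3 h4].
    by apply/andP; split; lra.
  by exists f.
rewrite big1// => f _; apply: null.
by rewrite divr_gt0//= ler_pdivrMr// mulrC -ler_pdivrMr// ltW.
Qed.

(** Where the [l]-Lipschitz function has absolute value at least [c * s], it has no zero within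
    distance [c * s / (2 * l)]: this is the hole. *)
Lemma level_set_leb0 Z (u : pt -> R) (l c r : R) : 0 < l -> 0 < c -> 0 < r ->
  (forall p q, `|u p - u q| <= l * enorm (p - q)) ->
  (forall p, Z p -> u p = 0) ->
  (forall p, Z p -> forall s, 0 < s <= r ->
    exists2 p', enorm (p - p') <= s & c * s <= `|u p'|) ->
  bounded_pt Z -> leb Z = 0%E.
Proof.
move=> l0 c0 r0 ul u0 H; apply: (@porous_leb0 _ (c / (2 * l)) r) => //.
  by rewrite divr_gt0// mulr_gt0.
move=> p Zp s sr; have [p' pp' cu] := H p Zp s sr.
exists p' => // q p'q Zq; have s0 : 0 < s by case/andP: sr.
have := ul p' q; rewrite (u0 q Zq) subr0 => /(le_trans cu).
move=> /le_trans/(_ (ler_wpM2l (ltW l0) p'q)).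
have -> : l * (c / (2 * l) * s) = c * s / 2 by field; rewrite gt_eqF.
by have : 0 < c * s by [exact: mulr_gt0]; lra.
Qed.

(** Porosity is wanted at a uniform scale and on bounded sets only; countably many pieces with [v]
    bounded below exhaust [Z]. *)
Lemma leb0_exhaust Z (v : pt -> R) : (forall p, Z p -> 0 < v p) ->
  (forall r M, 0 < r -> leb (Z `&` [set p | r <= v p /\ enorm p <= M]) = 0%E) ->
  leb Z = 0%E.
Proof.
move=> vZ H.
apply: (@sub_leb0 _ _ _ (\bigcup_k (Z `&` [set p | k.+1%:R^-1 <= v p /\ enorm p <= k%:R]))).
  move=> p Zp; have v0 := vZ p Zp.
  exists (maxn (Num.bound (v p)^-1) (Num.bound (enorm p))) => //; split => //.
  have h1 := archi_boundP (ltW (etrans (invr_gt0 _) v0)).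
  have h2 := archi_boundP (enorm_ge0 p).
  split; last by apply: (le_trans (ltW h2)); rewrite ler_nat leq_maxr.
  rewrite -[leRHS]invrK lef_pV2 ?posrE ?invr_gt0 ?ltr0n//.
  by apply: (le_trans (ltW h1)); rewrite ler_nat ltnW// ltnS leq_maxl.
by apply: leb0_bigcup => k; apply: H; rewrite invr_gt0.
Qed.

(** The point moves straight towards an almost nearest point of [E]; [eta] pays for the infimum not
    being attained. *)
Lemma move_toward E p (s eta : R) : E !=set0 -> 0 < s <= edist p E -> 0 < eta ->
  exists2 p', enorm (p - p') <= s & edist p' E <= edist p E - s + eta.
Proof.
move=> E0 /andP[s0 sd] eta0.
have [|e Ee pe] := @edist_adherent _ _ p E (edist p E + eta) E0; first by lra.
have pe0 : 0 < enorm (p - e) by apply: lt_le_trans (edist_le p Ee); lra.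
pose th := s / enorm (p - e).
have th1 : th <= 1 by rewrite ler_pdivrMr// mul1r (le_trans sd)// edist_le.
have th0 : 0 <= th by rewrite divr_ge0 ?ltW.
have ths : th * enorm (p - e) = s by rewrite /th divfK ?gt_eqF.
exists (p - th *: (p - e)).
  by rewrite opprB addrC subrK enormZ ger0_norm// ths.
apply: (le_trans (edist_le _ Ee)).
have -> : p - th *: (p - e) - e = (1 - th) *: (p - e).
  by rewrite scalerBl scale1r addrAC.
by rewrite enormZ ger0_norm ?subr_ge0// mulrBl mul1r ths; lra.
Qed.

Lemma sphere_leb0 E r : E !=set0 -> 0 < r -> leb [set p : pt | edist p E = r] = 0%E.
Proof.
move=> E0 r0; apply: (@leb0_exhaust _ (fun=> 1)) => // r' M _.
apply: (@level_set_leb0 _ (fun p => edist p E - r) 1 (2^-1) r) => //.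
- by move=> p q; rewrite mul1r opprB addrA subrK edist_lip_abs.
- by move=> p [/= -> _]; rewrite subrr.
- move=> p [/= pr _] s sr; have [s0 _] := andP sr.
  have [||p' pp' H] := @move_toward E p s (s / 2) E0; rewrite ?pr//; first by lra.
  by exists p' => //; rewrite distrC; apply: le_trans (ler_norm _); lra.
- by exists M => p [_ []].
Qed.

Lemma distance_ratio_leb0_lt E1 E2 (a b : R) : E1 !=set0 -> E2 !=set0 -> 0 <= b < a ->
  leb [set p : pt | a * edist p E1 = b * edist p E2 /\ 0 < edist p E1] = 0%E.
Proof.
move=> E10 E20 /andP[b0 ba].
apply: (@leb0_exhaust _ (fun p => edist p E1)) => [p []//|r M r0].
apply: (@level_set_leb0 _ (fun p => a * edist p E1 - b * edist p E2)
  (a + b) ((a - b) / 2) r) => //; try lra.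
- move=> p q; have := edist_lip_abs p q E10; have := edist_lip_abs p q E20.
  by rewrite !ler_norml => /andP[? ?] /andP[? ?]; apply/andP; split; nra.
- by move=> p [/= [-> _] _]; rewrite subrr.
- move=> p [/= [pE _] [rp _]] s /andP[s0 sr].
  (* The move lowers [a * edist p E1] by about [a * s] and [b * edist p E2] by at most [b * s]. The
     error term spends half of the gain [(a - b) * s]. *)
  have [||p' pp' H] := @move_toward E1 p s ((a - b) / (2 * a) * s) E10.
  + by rewrite s0 (le_trans sr).
  + by rewrite mulr_gt0// divr_gt0; lra.
  exists p' => //; rewrite distrC; apply: le_trans (ler_norm _).
  have := edist_lip p p' E20.
  have : a * ((a - b) / (2 * a) * s) = (a - b) / 2 * s by field; lra.
  by nra.
- by exists M => p [_ []].
Qed.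

Lemma distance_ratio_leb0 E1 E2 (a b : R) : E1 !=set0 -> E2 !=set0 ->
  0 <= a -> 0 <= b -> a != b ->
  leb [set p : pt | [/\ a * edist p E1 = b * edist p E2, 0 < edist p E1 &
    0 < edist p E2]] = 0%E.
Proof.
move=> E10 E20 a0 b0; rewrite neq_lt => /orP[ab|ba].
- apply: (sub_leb0 _ (@distance_ratio_leb0_lt E2 E1 b a E20 E10 _)) => [p [/= pE _ d2]|]; first by split.
  by rewrite a0.
- apply: (sub_leb0 _ (@distance_ratio_leb0_lt E1 E2 a b E10 E20 _)) => [p []//|].
  by rewrite b0.
Qed.

(* Moving from [p] towards [q] by a factor [th] makes [d(., E)^2 - |. - q|^2]
   grow by at least [th * d(q, E)^2], since this is affine for each point of [E]. *)
Lemma bisector_leb0 E q : E !=set0 -> bounded_pt E -> 0 < edist q E ->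
  leb [set p : pt | edist p E = enorm (p - q)] = 0%E.
Proof.
move=> E0 [D ED] rho0; set rho := edist q E in rho0.
apply: (@leb0_exhaust _ (fun p => enorm (p - q))).
  move=> p /= pE; rewrite lt_def enorm_ge0 andbT; apply/eqP => p0.
  move: (enorm_eq0 p0) => /eqP; rewrite subr_eq0 => /eqP pq.
  by move: rho0; rewrite /rho -pq pE p0 ltxx.
move=> r M r0.
pose T := `|M| + enorm q + `|D|.
have T0 : 0 < T.
  have [e Ee] := E0; have := edist_le q Ee; have := ED e Ee.
  have := enormD q (- e); rewrite enormN; have := ler_norm D; have := normr_ge0 M.
  by rewrite /T; rewrite -/rho; lra.
(* The squared distances from the moved point to [e] and to [q] will differ by at least
   [s / T * rho ^+ 2]. Each distance is at most [2 * T], so dividing by their sum costs at most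
   [4 * T]. *)
pose c := rho ^+ 2 / (T * (4 * T)).
have c0 : 0 < c by rewrite divr_gt0 ?exprn_gt0 ?mulr_gt0//; lra.
apply: (@level_set_leb0 _ (fun p => edist p E - enorm (p - q)) 2 c r) => //.
- move=> p p'; have := edist_lip_abs p p' E0.
  have := enorm_tri p' p q; have := enorm_tri p p' q; rewrite (enormB p' p).
  by rewrite !ler_norml => h1 h2 /andP[h3 h4]; apply/andP; split; lra.
- by move=> p [/= -> _]; rewrite subrr.
- move=> p [/= pE [rp pM]] s /andP[s0 sr].
  have pq0 : 0 < enorm (p - q) by lra.
  pose th := s / enorm (p - q).
  have th1 : th <= 1 by rewrite ler_pdivrMr// mul1r (le_trans sr).
  have th0 : 0 < th by rewrite divr_gt0.
  have ths : th * enorm (p - q) = s by rewrite /th divfK ?gt_eqF.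
  have pqT : enorm (p - q) <= T.
    have := enormD p (- q); rewrite enormN /T; have := ler_norm M.
    by have := normr_ge0 D; lra.
  have p'q : enorm (p - th *: (p - q) - q) = (1 - th) * enorm (p - q).
    rewrite -[in RHS](ger0_norm (x := 1 - th)) ?subr_ge0// -enormZ.
    by rewrite scalerBl scale1r addrAC.
  have pp' : enorm (p - (p - th *: (p - q))) = s.
    by rewrite opprB addrC subrK enormZ gtr0_norm.
  exists (p - th *: (p - q)); first by rewrite pp'.
  apply: le_trans (ler_norm _); rewrite lerBrDl.
  apply: edist_ge => // e Ee.
  set p' := p - th *: (p - q) in p'q pp' *.
  have sq : enorm (p' - e) ^+ 2 - enorm (p' - q) ^+ 2 =
      (1 - th) * (enorm (p - e) ^+ 2 - enorm (p - q) ^+ 2) + th * enorm (q - e) ^+ 2.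
    rewrite !enorm_sqr mulrBr !mulr_sumr -!sumrN -!big_split/=.
    apply: eq_bigr => i _; rewrite /p' !mxE; ring.
  have qe : rho <= enorm (q - e) by exact: edist_le.
  have pe : enorm (p - q) <= enorm (p - e) by rewrite -pE; exact: edist_le.
  have p'e : enorm (p' - e) <= 2 * T.
    have h1 := enorm_tri p p' e; have h2 := enormD p (- e); rewrite enormN in h2.
    have := ED e Ee; have := ler_norm D; have := ler_norm M.
    have := enorm_ge0 q; rewrite (enormB p' p) pp' in h1.
    have : s <= T by rewrite -ths; nra.
    by rewrite /T in pqT *; lra.
  have key : th * rho ^+ 2 <= enorm (p' - e) ^+ 2 - enorm (p' - q) ^+ 2.
    rewrite sq; have : th * rho ^+ 2 <= th * enorm (q - e) ^+ 2.
      by rewrite ler_pM2l// lerXn2r ?nnegrE ?enorm_ge0 ?(ltW rho0).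
    have : enorm (p - q) ^+ 2 <= enorm (p - e) ^+ 2.
      by rewrite lerXn2r ?nnegrE ?enorm_ge0.
    have := mulr_ge0 (_ : 0 <= 1 - th) (_ : 0 <= enorm (p - e) ^+ 2 - enorm (p - q) ^+ 2).
    rewrite !subr_ge0 => H h1 h2; have := H th1 h1; lra.
  have p'qT : enorm (p' - q) <= 2 * T.
    by rewrite p'q; have := enorm_ge0 (p - q); nra.
  have cs : c * s * (4 * T) <= th * rho ^+ 2.
    rewrite /c -ths.
    have -> : rho ^+ 2 / (T * (4 * T)) * (th * enorm (p - q)) * (4 * T) =
      th * rho ^+ 2 * (enorm (p - q) / T) by field; rewrite gt_eqF.
    apply: ler_piMr; first by rewrite mulr_ge0 ?sqr_ge0 ?(ltW th0).
    by rewrite ler_pdivrMr// mul1r.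
  have c's : 0 < c * s by rewrite mulr_gt0.
  rewrite leNgt; apply/negP => lt.
  by have := enorm_ge0 (p' - e); have := enorm_ge0 (p' - q); nra.
- by exists M => p [_ []].
Qed.

End Porosity.

(** * Jordan measurable sets *)

Section Jordan.
Variables (R : realType) (n : nat).
Local Notation edist := Defs.edist.
Local Notation pt := 'rV[R]_n.+1.
Implicit Types (A B E S X : set pt) (p q y z : pt).

Lemma bounded_sub A B : A `<=` B -> bounded_pt B -> bounded_pt A.
Proof. by move=> AB [M BM]; exists M => p /AB/BM. Qed.

Lemma bounded_setU A B : bounded_pt A -> bounded_pt B -> bounded_pt (A `|` B).
Proof.
move=> [M AM] [M' BM]; exists (Num.max M M') => p [/AM|/BM] pM;
  by rewrite le_max pM ?orbT.
Qed.

Lemma bounded_closure A : bounded_pt A -> bounded_pt (closure A).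
Proof.
move=> [M AM]; exists (M + 1) => p /closure_enormP/(_ 1 ltr01)[q /AM qM pq].
have := enormD (p - q) q; rewrite subrK; lra.
Qed.

Lemma bounded_leb A : bounded_pt A -> (leb A < +oo)%E.
Proof.
move=> [M AM].
apply: (@le_lt_trans _ _ (leb (box (const_mx (- M)) (const_mx M : pt)))).
  apply: le_leb => p /AM pM i; rewrite !mxE -ler_norml.
  exact: le_trans (coord_le_enorm _ _) pM.
by apply: le_lt_trans (leb_box _ _) _; rewrite ltry.
Qed.

(** Since [fine] sends an infinite measure to 0, this is used together with boundedness. *)
Definition meas A : R := fine (leb A).

Lemma measE A : bounded_pt A -> leb A = (meas A)%:E.
Proof.
by move=> bA; rewrite fineK// ge0_fin_numE ?leb_ge0// bounded_leb.
Qed.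

Lemma meas_ge0 A : 0 <= meas A.
Proof. exact/fine_ge0/leb_ge0. Qed.

Lemma meas_eq0 A : leb A = 0%E -> meas A = 0.
Proof. by rewrite /meas => ->. Qed.

Lemma le_meas A B : bounded_pt B -> A `<=` B -> meas A <= meas B.
Proof.
move=> bB AB; rewrite -lee_fin -!measE//; first exact: le_leb.
exact: bounded_sub bB.
Qed.

Lemma measU A B : bounded_pt A -> bounded_pt B ->
  meas (A `|` B) <= meas A + meas B.
Proof.
move=> bA bB; rewrite -lee_fin EFinD -!measE//; first exact: lebU.
exact: bounded_setU.
Qed.

Lemma le_measU X A B : bounded_pt A -> bounded_pt B -> X `<=` A `|` B ->
  meas X <= meas A + meas B.
Proof.
move=> bA bB XAB; apply: le_trans (measU bA bB).
by apply: le_meas => //; exact: bounded_setU.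
Qed.

Lemma meas_splitID X A : bounded_pt X -> leb_measurable A ->
  meas X = meas (X `&` A) + meas (X `\` A).
Proof.
move=> bX mA; apply: EFin_inj; rewrite EFinD -!measE//.
- by apply: bounded_sub bX => p [].
- by apply: bounded_sub bX => p [].
Qed.

Lemma le_meas_null A B : bounded_pt A -> bounded_pt B -> leb (A `\` B) = 0%E ->
  meas A <= meas B.
Proof.
move=> bA bB AB0; rewrite -[meas B]add0r -(meas_eq0 AB0); apply: le_measU => //.
  by apply: bounded_sub bA => p [].
by move=> p Ap; have [Bp|Bp] := pselect (B p); [right|left].
Qed.

Lemma leb_setD_trans A B C : leb (A `\` B) = 0%E -> leb (B `\` C) = 0%E ->
  leb (A `\` C) = 0%E.
Proof.
move=> AB BC; apply: (sub_leb0 _ (leb0U AB BC)) => p [Ap Cp].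
by have [Bp|Bp] := pselect (B p); [right|left].
Qed.

Lemma setD_leb0_sub A B : A `<=` B -> leb (A `\` B) = 0%E.
Proof. by move=> AB; rewrite (_ : A `\` B = set0) ?leb_set0// setD_eq0. Qed.

Lemma meas_setD A B : bounded_pt A -> bounded_pt B -> leb_measurable B -> leb (B `\` A) = 0%E ->
  meas (A `\` B) = meas A - meas B.
Proof.
move=> bA bB mB BA0; rewrite (meas_splitID bA mB).
suff -> : meas (A `&` B) = meas B by ring.
apply/eqP; rewrite eq_le; apply/andP; split; first by apply: le_meas => // p [].
apply: le_meas_null => //; first by apply: bounded_sub bB => p [].
by apply: (sub_leb0 _ BA0) => p [Bp AB]; split => // Ap; apply: AB.
Qed.

(** Membership in [isJ] without regular closedness, so that it is kept by differences and
    intersections and applies to components. *)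
Definition jordan E := bounded_pt E /\ leb (bdry E) = 0%E.

Lemma jordan_leb_measurable E : jordan E -> leb_measurable E.
Proof.
move=> [_ bE]; rewrite (_ : E = interior E `|` (E `\` interior E)).
  apply: leb_measurable_setU; first by apply: leb_measurable_open; exact: open_interior.
  by apply: leb_measurable_null; apply: (sub_leb0 _ bE) => p [Ep iE]; split => //; exact: subset_closure.
by rewrite setDE setUIr setUCr setIT (setUidr (@interior_subset _ _)).
Qed.

Lemma bdryU A B : bdry (A `|` B) `<=` bdry A `|` bdry B.
Proof.
move=> p [+ iAB]; rewrite closureU => -[cA|cB]; [left|right]; split => //.
- by move=> iA; apply: iAB; apply: filterS iA; exact: subsetUl.
- by move=> iB; apply: iAB; apply: filterS iB; exact: subsetUr.
Qed.

Lemma bdryC A : bdry (~` A) = bdry A.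
Proof. by rewrite /bdry closure_setC interiorC !setDE setCK setIC. Qed.

Lemma bdryI A B : bdry (A `&` B) `<=` bdry A `|` bdry B.
Proof.
by rewrite -[A `&` B]setCK setCI bdryC => p /bdryU; rewrite !bdryC.
Qed.

Lemma bdryD A B : bdry (A `\` B) `<=` bdry A `|` bdry B.
Proof. by rewrite setDE => p /bdryI; rewrite bdryC. Qed.

Lemma closureK A : closure (closure A) = closure A.
Proof. exact/esym/(closure_id _).1/closed_closure. Qed.

Lemma ci_ci A : ci (ci A) = ci A.
Proof.
apply/seteqP; split; rewrite /ci.
  rewrite -[X in _ `<=` X]closureK; by apply: closureS; exact: interior_subset.
apply: closureS; rewrite -{1}((interior_id A°).1 (@open_interior _ A)).
by apply: interiorS; exact: subset_closure.
Qed.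

Lemma ci_sub_closure A : ci A `<=` closure A.
Proof. by apply: closureS; exact: interior_subset. Qed.

Lemma interior_sub_ci A : interior A `<=` interior (ci A).
Proof.
rewrite -{1}((interior_id A°).1 (@open_interior _ A)).
by apply: interiorS; exact: subset_closure.
Qed.

Lemma bdry_ci A : bdry (ci A) `<=` bdry A.
Proof.
move=> p [cA iA]; split; last by move/interior_sub_ci.
by rewrite /ci closureK in cA; exact: ci_sub_closure.
Qed.

Lemma jordan_sub E A B C : bounded_pt E -> bdry E `<=` bdry A `|` bdry B ->
  jordan A -> jordan B -> E = C -> jordan C.
Proof.
by move=> bE sE [_ A0] [_ B0] <-; split => //; apply: (sub_leb0 sE); exact: leb0U.
Qed.

Lemma jordanU A B : jordan A -> jordan B -> jordan (A `|` B).
Proof.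
move=> jA jB; apply: (jordan_sub _ (@bdryU A B) jA jB) => //.
exact: bounded_setU jA.1 jB.1.
Qed.

Lemma jordanI A B : jordan A -> jordan B -> jordan (A `&` B).
Proof.
move=> jA jB; apply: (jordan_sub _ (@bdryI A B) jA jB) => //.
by apply: bounded_sub jA.1 => p [].
Qed.

Lemma jordanD A B : jordan A -> jordan B -> jordan (A `\` B).
Proof.
move=> jA jB; apply: (jordan_sub _ (@bdryD A B) jA jB) => //.
by apply: bounded_sub jA.1 => p [].
Qed.

Lemma jordan_ci A : jordan A -> isJ (ci A).
Proof.
move=> [bA A0]; split; last split; last exact: sub_leb0 (@bdry_ci A) A0.
  exact: bounded_sub (@ci_sub_closure A) (bounded_closure bA).
by rewrite ci_ci.
Qed.

Lemma isJ_jordan A : isJ A -> jordan A.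
Proof. by move=> [bA [_ A0]]. Qed.

Lemma isJ_closed A : isJ A -> closed A.
Proof. by move=> [_ [-> _]]; exact: closed_closure. Qed.

Lemma isJ_leb_measurable A : isJ A -> leb_measurable A.
Proof. by move=> /isJ_closed/leb_measurable_closed. Qed.

Lemma leb_ciD A : jordan A -> leb (ci A `\` A) = 0%E.
Proof.
move=> [_ A0]; apply: sub_leb0 A0 => p [/ci_sub_closure cA Ap].
by split => // /interior_subset.
Qed.

Lemma leb_Dci A : jordan A -> leb (A `\` ci A) = 0%E.
Proof.
move=> [_ A0]; apply: sub_leb0 A0 => p [Ap cA]; split; first exact: subset_closure.
by move=> iA; apply: cA; exact: subset_closure.
Qed.

Lemma isJU A B : isJ A -> isJ B -> isJ (A `|` B).
Proof.
move=> JA JB; have [bAB AB0] := jordanU (isJ_jordan JA) (isJ_jordan JB).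
split => //; split => //; apply/seteqP; split.
  move=> p [|]; [rewrite {1}JA.2.1|rewrite {1}JB.2.1];
    apply: closureS; apply: interiorS; by [exact: subsetUl|exact: subsetUr].
move=> p /ci_sub_closure; rewrite -(closure_id _).1//.
by apply: closedU; exact: isJ_closed.
Qed.

Lemma isJ0 : isJ (set0 : set pt).
Proof.
split; first by exists 0.
by rewrite /ci /bdry interior0 closure0 set0D leb_set0.
Qed.

(* The parameter is the supremum of those [g] with [meas (W g) <= tg]. *)
Lemma measure_ivt (W : R -> set pt) (al be tg : R) : al <= be ->
  (forall g, leb_measurable (W g)) ->
  (forall g g', al <= g -> g <= g' -> g' <= be -> W g `<=` W g') ->
  bounded_pt (W be) -> meas (W al) <= tg <= meas (W be) ->
  (forall g p, al <= g < be -> (forall g', g < g' <= be -> W g' p) -> W g p) ->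
  (forall g, al < g <= be -> exists2 D : set pt, leb D = 0%E &
     forall p, W g p -> ~ D p -> exists2 g', al <= g' < g & W g' p) ->
  exists2 g, al <= g <= be & meas (W g) = tg.
Proof.
move=> ab mW monoW bW /andP[tg0 tg1] right left.
pose G := [set g | al <= g <= be /\ meas (W g) <= tg].
have Gal : G al by rewrite /G/= lexx ab.
have hG : has_sup G by split; [exists al|exists be => g [/andP[]]].
have g0a : al <= sup G by apply: ub_le_sup hG.2 _ Gal.
have g0b : sup G <= be by apply: ge_sup hG.1 _ => g [/andP[]].
have bWg g : al <= g -> g <= be -> bounded_pt (W g).
  by move=> g1 g2; exact: bounded_sub (monoW g be g1 g2 (lexx be)) bW.
exists (sup G); first by rewrite g0a.
pose T := caratheodory_type (@lebm R n).
pose mu : set T -> \bar R := @lebm R n.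
apply/eqP; rewrite eq_le; apply/andP; split.
(* Upper bound: [s k] increases to [sup G], each [W (s k)] has measure at most [tg], and their union
   misses only points of the null set [D]. *)
- have [<-|g0al] := eqVneq al (sup G); first by case: Gal.
  have alg0 : al < sup G by rewrite lt_def eq_sym g0al.
  have [D D0 DW] := left _ (introT andP (conj alg0 g0b)).
  pose s k : R := sup G - (sup G - al) / k.+1%:R.
  have s1 k : al <= s k < sup G.
    have : 0 < (sup G - al) / k.+1%:R by rewrite divr_gt0// subr_gt0.
    have : (sup G - al) / k.+1%:R <= sup G - al.
      by rewrite ler_pdivrMr ?ltr0n// ler_peMr ?subr_ge0// ler1n.
    rewrite /s; move: (_ / _) => d d1 d2.
    by apply/andP; split; lra.
  have snd : {homo s : i j / (i <= j)%N >-> i <= j}.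
    move=> i j ij; rewrite /s lerD2l lerN2 ler_wpM2l ?subr_ge0//.
    by rewrite lef_pV2 ?posrE ?ltr0n// ler_nat.
  have cv : mu (W (s k)) @[k --> \oo] --> mu (\bigcup_k W (s k)).
    apply: (@nondecreasing_cvg_mu _ T R mu).
    - by move=> k; exact: mW.
    - by apply: bigcupT_measurable => k; exact: mW.
    - move=> i j ij; apply/subsetPset; apply: monoW.
      + by case/andP: (s1 i).
      + exact: snd.
      + by have /andP[_ /ltW/le_trans] := s1 j; apply.
  have le_tg : (leb (\bigcup_k W (s k)) <= tg%:E)%E.
    rewrite -[leb _]/(mu _) -(cvg_lim _ cv)//; apply: lime_le.
      by apply/cvg_ex; exists (mu (\bigcup_k W (s k))).
    apply: nearW => k; have /andP[sk1 sk2] := s1 k.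
    have [g Gg kg] : exists2 g, G g & s k < g.
      have /sup_adherent/(_ hG)[g Gg kg] : 0 < sup G - s k by rewrite subr_gt0.
      by rewrite subKr in kg; exists g.
    have [/andP[_ gb] Wg] := Gg.
    apply: (@le_trans _ _ (leb (W g))); last by rewrite measE ?lee_fin//; apply: bWg; lra.
    by apply: le_leb; apply: monoW => //; exact: ltW.
  rewrite -lee_fin -measE; last exact: bWg.
  rewrite -[tg%:E]add0e -D0; apply: le_trans (leeD (lexx _) le_tg).
  apply: le_trans (lebU _ _); apply: le_leb => p Wp.
  have [Dp|Dp] := pselect (D p); [by left|right].
  have [g' /andP[g'1 g'2] Wg'] := DW p Wp Dp.
  have sg : 0 < sup G - g' by rewrite subr_gt0.
  pose k := Num.bound ((sup G - al) / (sup G - g')).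
  exists k => //; apply: (monoW g' _ g'1) => //; last first.
    by have /andP[_ /ltW/le_trans] := s1 k; apply.
  rewrite /s lerBrDr -lerBrDl ler_pdivrMr ?ltr0n// mulrC -ler_pdivrMr//.
  apply: (le_trans (ltW (archi_boundP _))); last by rewrite ler_nat.
  by rewrite divr_ge0 ?subr_ge0 ?ltW.
(* Lower bound: [s k] decreases to [sup G] from outside [G], so [W (s k)] has measure above [tg],
   and the intersection lies in [W (sup G)]. *)
- have [->|g0be] := eqVneq (sup G) be; first by [].
  have g0lt : sup G < be by rewrite lt_def eq_sym g0be.
  pose s k : R := sup G + (be - sup G) / k.+1%:R.
  have s1 k : sup G < s k <= be.
    have : 0 < (be - sup G) / k.+1%:R by rewrite divr_gt0// subr_gt0.
    have : (be - sup G) / k.+1%:R <= be - sup G.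
      by rewrite ler_pdivrMr ?ltr0n// ler_peMr ?subr_ge0// ler1n.
    rewrite /s; move: (_ / _) => d d1 d2.
    by apply/andP; split; lra.
  have snd i j : (i <= j)%N -> s j <= s i.
    move=> ij; rewrite /s lerD2l ler_wpM2l ?subr_ge0//.
    by rewrite lef_pV2 ?posrE ?ltr0n// ler_nat.
  have sa k : al <= s k by case/andP: (s1 k) => /ltW/(le_trans g0a).
  have sb k : s k <= be by case/andP: (s1 k).
  have cv : mu (W (s k)) @[k --> \oo] --> mu (\bigcap_k W (s k)).
    apply: (@nonincreasing_cvg_mu _ T R mu).
    - by rewrite [X in (X < _)%E]measE ?ltry//; exact: bWg.
    - by move=> k; exact: mW.
    - by apply: bigcapT_measurable => k; exact: mW.
    - by move=> i j ij; apply/subsetPset; apply: monoW => //; exact: snd.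
  rewrite -lee_fin -measE; last exact: bWg.
  apply: (@le_trans _ _ (mu (\bigcap_k W (s k)))); last first.
    apply: le_leb => p Wp; apply: right; first by rewrite g0a.
    move=> g' /andP[g'1 g'2]; have sg : 0 < g' - sup G by rewrite subr_gt0.
    pose k := Num.bound ((be - sup G) / (g' - sup G)).
    apply: (monoW (s k) g') (Wp k I) => //.
    rewrite /s -lerBrDl ler_pdivrMr ?ltr0n// mulrC -ler_pdivrMr//.
    apply: (le_trans (ltW (archi_boundP _))); last by rewrite ler_nat.
    by rewrite divr_ge0 ?subr_ge0 ?ltW.
  rewrite -(cvg_lim _ cv)//; apply: lime_ge.
    by apply/cvg_ex; exists (mu (\bigcap_k W (s k))).
  apply: nearW => k; rewrite [X in (_ <= X)%E]measE; last exact: bWg.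
  rewrite lee_fin leNgt; apply/negP => /ltW lt.
  have : s k <= sup G by apply: ub_le_sup hG.2 _ _; split => //; rewrite sa sb.
  by have /andP[+ _] := s1 k; rewrite ltNge => /negP.
Qed.

(* [t] A + (1 - t) B up to null sets, for nested B, A: this is all that the
   metric estimates need to know about a measure average. *)
Definition is_avg t A B S :=
  [/\ isJ S, leb (B `\` S) = 0%E, leb (S `\` A) = 0%E,
      meas (S `\` B) <= t * meas (A `\` B) &
      meas (A `\` S) <= (1 - t) * meas (A `\` B)].

(** [ci] changes a Jordan set by a null set. Between [B] and [A], the exact measure of [W] then
    determines both differences. *)
Lemma is_avg_ci t A B W : jordan A -> jordan B -> B `<=` A -> jordan W ->
  leb (B `\` W) = 0%E -> leb (W `\` A) = 0%E ->
  meas W = t * meas A + (1 - t) * meas B -> is_avg t A B (ci W).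
Proof.
move=> jA jB BA jW BW WA mW.
have jS := jordan_ci jW.
have BS := leb_setD_trans BW (leb_Dci jW).
have SA := leb_setD_trans (leb_ciD jW) WA.
have [bA _] := jA; have [bB _] := jB; have [bW _] := jW; have [bS _] := jS.
have mS : meas (ci W) = meas W.
  apply/eqP; rewrite eq_le; apply/andP; split.
    exact: le_meas_null bS bW (leb_ciD jW).
  exact: le_meas_null bW bS (leb_Dci jW).
have AB := meas_setD bA bB (jordan_leb_measurable jB) (setD_leb0_sub BA).
have SB := meas_setD bS bB (jordan_leb_measurable jB) BS.
have AS := meas_setD bA bS (isJ_leb_measurable jS) SA.
by split => //; rewrite AB ?SB ?AS mS mW; lra.
Qed.

End Jordan.

(** * Measure averages of simply different sets *)

Section Interpolation.
Variables (R : realType) (n : nat).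
Local Notation center := Defs.center.
Local Notation davg := Defs.davg.
Local Notation edist := Defs.edist.
Local Notation pt := 'rV[R]_n.+1.
Implicit Types (A B E S X : set pt) (p q y z : pt).

Definition lip (l : R) (u : pt -> R) := forall p q, u p <= u q + l * enorm (p - q).

Lemma lip_open (l : R) u : 0 < l -> lip l u -> open [set p | 0 < u p].
Proof.
move=> l0 ul; rewrite openE => p /= up; apply/nbhs_enormP.
exists (u p / l); first by rewrite divr_gt0.
by move=> q; rewrite ltr_pdivlMr// => pq; have := ul p q; rewrite /=; lra.
Qed.

Lemma lipN (l : R) u : lip l u -> lip l (fun p => - u p).
Proof. by move=> ul p q; have := ul q p; rewrite (enormB q p); lra. Qed.

Lemma lip_closed (l : R) u : 0 < l -> lip l u -> closed [set p | 0 <= u p].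
Proof.
move=> l0 ul; have := lip_open l0 (lipN ul); move/open_closedC.
congr closed; apply/seteqP; split => p /=; rewrite oppr_gt0 leNgt => H.
  exact/negP.
by apply/negP.
Qed.

Lemma bdry_ge0 (l : R) u : 0 < l -> lip l u -> bdry [set p | 0 <= u p] `<=` [set p | u p = 0].
Proof.
move=> l0 ul p [+ ip]; rewrite -(closure_id _).1; last exact: lip_closed ul.
move=> /= up; apply/eqP; rewrite eq_le up andbT leNgt; apply/negP => up0.
apply: ip; have := lip_open l0 ul; rewrite openE => /(_ p up0).
by apply: filterS => q /=; exact: ltW.
Qed.

Definition blend (phA phB : pt -> R) (g : R) p := g * phA p + (1 - g) * phB p.

(* [phA] and [phB] are the signed distances to [A] and [B]; when [B] is empty,
   [phB] is minus the distance to the center of [A] and [E2] is that center. *)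
Section Blend.
Variables (A B E1 E2 : set pt) (phA phB : pt -> R) (M : R).
Hypotheses (jA : jordan A) (JB : isJ B) (BA : B `<=` A).
Hypotheses (E10 : E1 !=set0) (E20 : E2 !=set0).
Hypotheses (absA : forall p, `|phA p| = edist p E1)
           (absB : forall p, `|phB p| = edist p E2).
Hypotheses (lipA : lip 1 phA) (lipB : lip 1 phB).
Hypothesis phBA : forall p, phB p <= phA p.
Hypotheses (farA : forall p, M < enorm p -> `|phA p + enorm p| <= M)
           (farB : forall p, M < enorm p -> `|phB p + enorm p| <= M).
Hypotheses (nullA : leb [set p | phA p = 0] = 0%E)
           (nullB : leb [set p | phB p = 0] = 0%E).
Hypotheses (posA : A `<=` [set p | 0 <= phA p])
           (posA0 : leb ([set p | 0 <= phA p] `\` A) = 0%E).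
Hypotheses (posB : B `<=` [set p | 0 <= phB p])
           (posB0 : leb ([set p | 0 <= phB p] `\` B) = 0%E).
Hypothesis half0 : leb [set p | blend phA phB 2^-1 p = 0] = 0%E.

Let f := blend phA phB.
Let W g := [set p | 0 <= f g p].

(** Off the null zero sets of [phA] and [phB], a zero satisfies an equality between multiples of the
    two distances, with coefficients [|g|] and [|1 - g|]. These agree only for [g] equal to 1/2. *)
Lemma blend_leb0 g : leb [set p | f g p = 0] = 0%E.
Proof.
have [->|g2] := eqVneq g 2^-1; first exact: half0.
have ng : `|g| != `|1 - g|.
  apply/eqP => gg; move/eqP: g2; apply.
  have : g ^+ 2 = (1 - g) ^+ 2 by rewrite -(real_normK (num_real g)) gg real_normK ?num_real.
  by lra.
have H := distance_ratio_leb0 E10 E20 (normr_ge0 g) (normr_ge0 (1 - g)) ng.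
apply: (sub_leb0 _ (leb0U (leb0U nullA nullB) H)) => p /= fp.
have [pA|pA] := eqVneq (phA p) 0; first by left; left.
have [pB|pB] := eqVneq (phB p) 0; first by left; right.
right; split; last 2 first.
- by rewrite -absA normr_gt0.
- by rewrite -absB normr_gt0.
rewrite -absA -absB -!normrM -[RHS]normrN; congr (`|_|).
by move: fp; rewrite /f /blend; lra.
Qed.

Lemma blend_lip g : lip (`|g| + `|1 - g| + 1) (f g).
Proof.
move=> p q; rewrite /f /blend.
have hA : `|phA p - phA q| <= enorm (p - q).
  have := lipA p q; have := lipA q p; rewrite (enormB q p) ler_norml.
  by move=> *; apply/andP; split; lra.
have hB : `|phB p - phB q| <= enorm (p - q).
  have := lipB p q; have := lipB q p; rewrite (enormB q p) ler_norml.
  by move=> *; apply/andP; split; lra.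
have := ler_norm (g * (phA p - phA q)); have := ler_norm ((1 - g) * (phB p - phB q)).
rewrite !normrM => h1 h2.
have h3 : `|g| * `|phA p - phA q| <= `|g| * enorm (p - q) by rewrite ler_wpM2l.
have h4 : `|1 - g| * `|phB p - phB q| <= `|1 - g| * enorm (p - q) by rewrite ler_wpM2l.
have := enorm_ge0 (p - q); lra.
Qed.

Let l0 g : 0 < `|g| + `|1 - g| + 1 :> R.
Proof. by have := normr_ge0 g; have := normr_ge0 (1 - g); lra. Qed.

(** Far out both functions equal minus the norm up to a bounded error. The weights sum to 1, so the
    blend does as well, for every real [g]. *)
Lemma blend_bounded g : bounded_pt (W g).
Proof.
exists (`|M| + (`|g| + `|1 - g|) * `|M|) => p; rewrite /W /= /f /blend => fp.
have g1 := normr_ge0 g; have g2 := normr_ge0 (1 - g); have M0 := normr_ge0 M.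
rewrite leNgt; apply/negP => lt.
have gM : 0 <= (`|g| + `|1 - g|) * `|M| by rewrite mulr_ge0 ?addr_ge0.
have Mp : M < enorm p by have := ler_norm M; lra.
have := ler_norm (g * (phA p + enorm p)); have := ler_norm ((1 - g) * (phB p + enorm p)).
rewrite !normrM => h1 h2.
have h3 : `|g| * `|phA p + enorm p| <= `|g| * `|M|.
  by rewrite ler_wpM2l// (le_trans (farA Mp))// ler_norm.
have h4 : `|1 - g| * `|phB p + enorm p| <= `|1 - g| * `|M|.
  by rewrite ler_wpM2l// (le_trans (farB Mp))// ler_norm.
lra.
Qed.

Lemma blend_jordan g : jordan (W g).
Proof.
split; first exact: blend_bounded.
apply: (sub_leb0 _ (blend_leb0 g)).
exact: bdry_ge0 (l0 g) (@blend_lip g).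
Qed.

Lemma blend_mono g g' : g <= g' -> W g `<=` W g'.
Proof. by move=> gg p; rewrite /W /= /f /blend; have := phBA p; nra. Qed.

Lemma blend_ivt (tg : R) : meas B <= tg <= meas A ->
  exists2 g, 0 <= g <= 1 & meas (W g) = tg.
Proof.
move=> /andP[tB tA].
have W0 : W 0 = [set p | 0 <= phB p].
  by apply/funext => p; rewrite /W /f /blend /= mul0r add0r subr0 mul1r.
have W1 : W 1 = [set p | 0 <= phA p].
  by apply/funext => p; rewrite /W /f /blend /= mul1r subrr mul0r addr0.
apply: measure_ivt => //.
- by move=> g; apply: leb_measurable_closed; apply: lip_closed (l0 g) (@blend_lip g).
- by move=> g g' _ gg _; exact: blend_mono.
- exact: blend_bounded.
- apply/andP; split.
    apply: le_trans tB; apply: le_meas_null; [exact: blend_bounded|exact: JB.1|].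
    by rewrite W0.
  apply: (le_trans tA); apply: le_meas; first exact: blend_bounded.
  by rewrite W1.
- move=> g p /andP[g0 g1] H; rewrite /W/= leNgt; apply/negP => fp.
  have D0 := phBA p.
  (* Raising the parameter by [d] adds at most [- f g p / 2], so the blend stays negative at [p].
     The summand 1 keeps the denominator positive. *)
  pose d := Num.min (1 - g) (- f g p / 2 / (phA p - phB p + 1)).
  have d0 : 0 < d by rewrite lt_min subr_gt0 g1 !divr_gt0//; lra.
  have d1 : d <= 1 - g by rewrite ge_min lexx.
  have : d <= - f g p / 2 / (phA p - phB p + 1) by rewrite ge_min lexx orbT.
  rewrite ler_pdivlMr; last by lra.
  move=> d2; have : W (g + d) p by apply: H; apply/andP; split; lra.
  rewrite /W /= => d3.
  have : f (g + d) p = f g p + d * (phA p - phB p) by rewrite /f /blend; ring.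
  by nra.
- move=> g /andP[g0 g1]; exists [set p | f g p = 0]; first exact: blend_leb0.
  move=> p fp /eqP fp0; have {}fp : 0 < f g p by rewrite lt_def fp0.
  have D0 := phBA p.
  pose d := Num.min g (f g p / (phA p - phB p + 1)).
  have d0 : 0 < d by rewrite lt_min g0 divr_gt0//; lra.
  have d1 : d <= g by rewrite ge_min lexx.
  have : d <= f g p / (phA p - phB p + 1) by rewrite ge_min lexx orbT.
  rewrite ler_pdivlMr; last by lra.
  move=> d2; exists (g - d); first by apply/andP; split; lra.
  rewrite /W/=.
  have -> : f (g - d) p = f g p - d * (phA p - phB p) by rewrite /f /blend; ring.
  by nra.
Qed.

(* The minimizer picked in [-N, N] may lie outside [0, 1] or differ from the
   parameter of [blend_ivt], but the sets [W g] are nested, so that two of them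
   with the same measure agree up to a null set. *)
Lemma blend_avg t N : 0 <= t <= 1 -> 1 <= N ->
  is_avg t A B (ci (W (xget 0 [set g | -N <= g <= N /\
     forall xi, -N <= xi <= N ->
     `|meas (W g) - (t * meas A + (1 - t) * meas B)| <=
     `|meas (W xi) - (t * meas A + (1 - t) * meas B)| ]))).
Proof.
move=> /andP[t0 t1] N1; set tg := t * _ + _; set P := [set g | _].
have BAm : meas B <= meas A by apply: le_meas => //; exact: jA.1.
have tB : meas B <= tg by rewrite /tg; nra.
have tA : tg <= meas A by rewrite /tg; nra.
have [g0 /andP[g00 g01] Wg0] := blend_ivt (introT andP (conj tB tA)).
(* [g0] hits the target exactly and lies in the search interval because [1 <= N]; hence the minimum
   is 0 and every minimizer hits it. *)
have Pg0 : P g0.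
  split; first by apply/andP; split; lra.
  by move=> xi _; rewrite Wg0 subrr normr0.
have [_ /(_ g0)] : P (xget 0 P) by exact: xgetI Pg0.
move: (xget 0 P) => g; rewrite Wg0 subrr normr0 => H.
have {H}Wg : meas (W g) = tg.
  apply/eqP; rewrite -subr_eq0 -normr_le0; apply: H.
  by apply/andP; split; lra.
have bW h := @blend_bounded h.
have mW h := jordan_leb_measurable (blend_jordan h).
have W0 : W 0 = [set p | 0 <= phB p].
  by apply/funext => p; rewrite /W /f /blend /= mul0r add0r subr0 mul1r.
have W1 : W 1 = [set p | 0 <= phA p].
  by apply/funext => p; rewrite /W /f /blend /= mul1r subrr mul0r addr0.
have null h h' : h <= h' -> meas (W h') <= meas (W h) -> leb (W h' `\` W h) = 0%E.
  move=> hh mh; have bD : bounded_pt (W h' `\` W h) by apply: bounded_sub (bW h') => p [].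
  rewrite measE// meas_setD//; last exact/setD_leb0_sub/blend_mono.
  have : meas (W h) <= meas (W h') by apply: le_meas => //; exact: blend_mono.
  by move=> ?; congr (_%:E); lra.
have mW0 : meas (W 0) <= tg.
  by apply: le_trans tB; apply: le_meas_null => //; [exact: JB.1|rewrite W0].
have mW1 : tg <= meas (W 1).
  by apply: (le_trans tA); apply: le_meas => //; rewrite W1.
apply: is_avg_ci => //; first exact: isJ_jordan.
- exact: blend_jordan.
- apply: (@leb_setD_trans _ _ _ (W 0)); first by rewrite W0; exact: setD_leb0_sub.
  have [gle|glt] := leP 0 g; first exact/setD_leb0_sub/blend_mono.
  by apply: null; [exact: ltW|rewrite Wg].
- apply: (@leb_setD_trans _ _ _ (W 1)); last by rewrite W1.
  have [gle|glt] := leP g 1; first exact/setD_leb0_sub/blend_mono.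
  by apply: null; [exact: ltW|rewrite Wg].
Qed.

End Blend.

Lemma dS_far A : proper_set A -> bounded_pt A ->
  exists2 M, 0 <= M & forall p, M < enorm p -> `|dS p A + enorm p| <= M.
Proof.
move=> pA /bounded_closure[M AM]; have [z0 bz0] := bdry_nonempty pA.
have bM z : bdry A z -> enorm z <= M by case=> /AM.
have M0 : 0 <= M by apply: le_trans (enorm_ge0 z0) (bM _ bz0).
exists M => // p Mp; rewrite dS_out; last first.
  by move/subset_closure/AM; rewrite leNgt Mp.
have h1 : edist p (bdry A) <= enorm p + M.
  apply: (le_trans (edist_le p bz0)); apply: (le_trans (enormD _ _)).
  by rewrite enormN lerD2l bM.
have h2 : enorm p - M <= edist p (bdry A).
  apply: edist_ge; first by exists z0.
  move=> z /bM zM; have := enormD (p - z) z; rewrite subrK; lra.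
by rewrite ler_norml; apply/andP; split; lra.
Qed.

Lemma dS_lip1 A : proper_set A -> lip 1 (fun p => dS p A).
Proof. by move=> pA p q; rewrite mul1r; exact: dS_lip. Qed.

Lemma dS_eq0_leb0 A : proper_set A -> jordan A -> leb [set p | dS p A = 0] = 0%E.
Proof. by move=> pA jA; apply: sub_leb0 jA.2 => p; exact: dS_eq0_bdry. Qed.

Lemma dS_pos A : proper_set A -> A `<=` [set p | 0 <= dS p A].
Proof. by move=> pA p Ap /=; rewrite dS_in// edist_ge0. Qed.

Lemma dS_pos_leb0 A : proper_set A -> jordan A ->
  leb ([set p | 0 <= dS p A] `\` A) = 0%E.
Proof.
move=> pA [_ A0]; apply: sub_leb0 A0 => p [/= /(dS_ge0_closure _ pA) cA Ap].
by split => // /interior_subset.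
Qed.

Lemma closed_bounded_compact A : bounded_pt A -> closed A -> compact A.
Proof.
move=> [M AM] cA; apply: bounded_closed_compact => //.
exists M; split; first exact: num_real.
move=> x Mx p /AM pM; rewrite /= (mx_normrE p : `|p| = _).
apply/bigmax_leP; split => [|[i j] _].
  by apply: le_trans (ltW Mx); exact: le_trans (enorm_ge0 p) pM.
by rewrite ord1/=; apply: le_trans (ltW Mx); apply: le_trans pM; exact: coord_le_enorm.
Qed.

Lemma lip_continuous (l : R) u : 0 < l -> lip l u -> continuous u.
Proof.
move=> l0 ul p U /nbhs_ballP[e /= e0 eU]; apply/nbhs_enormP.
exists (e / l); first by rewrite divr_gt0.
move=> q; rewrite ltr_pdivlMr// => pq; apply: eU; rewrite /ball/=.
have := ul p q; have := ul q p; rewrite (enormB q p) ltr_norml => *.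
by apply/andP; split; lra.
Qed.

(** The signed distance attains its maximum on the compact closure. The maximum is positive, so the
    maximizer is interior and belongs to [A] even if [A] is not closed; thus [xget] in [center]
    picks a true maximizer. *)
Lemma centerP A : bounded_pt A -> interior A !=set0 ->
  A (center A) /\ 0 < dS (center A) A.
Proof.
move=> bA [x ix]; have Ax := interior_subset ix.
have pA : proper_set A by apply: bounded_proper => //; exists x.
have dx : 0 < dS x A by exact/dS_gt0_interior.
have [c cA cmax] : exists2 c, c \in closure A &
    forall p, p \in closure A -> dS p A <= dS c A.
  apply: EVT_max_rV.
  - by exists x; exact: subset_closure.
  - by apply: closed_bounded_compact; [exact: bounded_closure|exact: closed_closure].
  - apply: continuous_subspaceT; apply: lip_continuous ltr01 _.
    exact: dS_lip1.
have xc : dS x A <= dS c A by apply: cmax; rewrite inE; exact: subset_closure.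
have Ac : A c.
  by apply: interior_subset; apply/dS_gt0_interior => //; exact: lt_le_trans xc.
pose Q := [set q | A q /\ forall p, A p -> dS p A <= dS q A].
have Qc : Q c by split => // p Ap; apply: cmax; rewrite inE; exact: subset_closure.
have [H1 H2] : Q (center A) by exact: (@xgetI _ 0 Q c Qc).
by split => //; apply: lt_le_trans dx (H2 _ Ax).
Qed.

Lemma onbhd_lip E : E !=set0 -> lip 1 (fun p => - edist p E).
Proof.
move=> E0; apply: lipN => p q; rewrite mul1r; exact: edist_lip.
Qed.

Lemma leb_pt q : leb [set q] = 0%E.
Proof.
apply: leb_le0; apply: (@le_trans _ _ (leb (box q q))).
  by apply: le_leb => p -> i; rewrite lexx.
by apply: (le_trans (leb_box _ _)); rewrite (@vol_eq0 _ _ _ _ ord0).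
Qed.

Lemma davg_fun_blend g A B : A !=set0 -> B !=set0 ->
  davg_fun g A B = blend (fun p => dS p A) (fun p => dS p B) g.
Proof. by move=> A0 B0; apply/funext => p; rewrite /davg_fun !asboolT. Qed.

Lemma davg_fun_blend0 g A : A !=set0 ->
  davg_fun g A set0 = blend (fun p => dS p A) (fun p => - enorm (p - center A)) g.
Proof.
move=> A0; apply/funext => p.
rewrite /davg_fun asboolT// asboolF; last by case.
by rewrite /blend; ring.
Qed.

Lemma edist_set1 p q : edist p [set q] = enorm (p - q).
Proof.
apply/eqP; rewrite eq_le edist_le//=; apply: edist_ge; first by exists q.
by move=> _ ->.
Qed.

Lemma zero_measure_cond_set0 A : bounded_pt A -> interior A !=set0 ->
  zero_measure_cond A set0.
Proof.
move=> bA iA; have [x ix] := iA.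
have A0 : A !=set0 by exists x; exact: interior_subset ix.
have pA := bounded_proper A0 bA.
have [cA dc] := centerP bA iA; set q := center A in cA dc.
rewrite /zero_measure_cond (davg_fun_blend0 _ A0) -/q.
have bb : bounded_pt (bdry A).
  by apply: bounded_sub (bounded_closure bA) => p [].
rewrite dS_in// in dc.
apply: (sub_leb0 _ (bisector_leb0 (bdry_nonempty pA) bb dc)) => p /=.
rewrite /blend -dS_abs => H.
have -> : dS p A = enorm (p - q) by lra.
by rewrite ger0_norm ?enorm_ge0.
Qed.

Lemma onbhd_ivt A B (tg : R) : jordan A -> isJ B -> B !=set0 -> B `<=` A ->
  meas B <= tg <= meas A ->
  exists2 r, 0 <= r & meas (Onbhd B r `&` A) = tg.
Proof.
move=> jA JB B0 BA /andP[tB tA]; have [bA _] := jA.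
have [D D0 AD] : exists2 D, 0 <= D & forall p, A p -> edist p B <= D.
  have [b Bb] := B0; have [M AM] := bA.
  exists (M + enorm b).
    by rewrite addr_ge0 ?enorm_ge0// (le_trans (enorm_ge0 b))// AM//; exact: BA.
  move=> p /AM pM; apply: (le_trans (edist_le _ Bb)).
  by apply: (le_trans (enormD _ _)); rewrite enormN lerD2r.
have cl r : Onbhd B r = [set p | 0 <= r - edist p B].
  by apply/funext => p; rewrite /Onbhd /= subr_ge0.
have [||||||r /andP[r0 _] Wr] := @measure_ivt _ _ (fun r => Onbhd B r `&` A) 0 D tg D0.
- move=> r; apply: leb_measurable_setI; last exact: jordan_leb_measurable.
  apply: leb_measurable_closed; rewrite cl; apply: (@lip_closed 1) => // p q.
  by have := onbhd_lip B0 p q; lra.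
- by move=> g g' _ gg _ p [pg Ap]; split => //; exact: le_trans gg.
- by apply: bounded_sub bA => p [].
- apply/andP; split.
    apply: le_trans tB; apply: le_meas; first exact: JB.1.
    move=> p [/(edist_eq0 B0) cB _].
    by rewrite (closure_id B).1//; exact: isJ_closed.
  by apply: (le_trans tA); apply: le_meas => [|p Ap];
    [apply: bounded_sub bA => p []|split => //; exact: AD].
- move=> g p /andP[g0 gD] H; split; last first.
    by have [] := H D _; rewrite ?gD ?lexx.
  apply/ler_addgt0Pr => e e0.
  have [] : (Onbhd B (Num.min D (g + e)) `&` A) p.
    by apply: H; rewrite lt_min gD ltrDl e0/= ge_min lexx.
  by rewrite /Onbhd/= le_min => /andP[].
- move=> g /andP[g0 gD]; exists [set p | edist p B = g]; first exact: sphere_leb0.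
  move=> p [pg Ap] /eqP pne; exists (Num.max 0 (edist p B)).
    by rewrite le_max lexx/= gt_max g0 lt_def eq_sym pne.
  by split => //; rewrite /Onbhd/= le_max lexx orbT.
- by exists r.
Qed.

(** [A] is merely [jordan] since it will be [B] with one component, or the merged small components,
    adjoined. *)
Lemma avg1_spec N t A B : 1 <= N -> 0 <= t <= 1 -> jordan A -> isJ B ->
  B `<=` A -> interior A !=set0 -> is_avg t A B (avg1 N t A B).
Proof.
move=> N1 t01 jA JB BA iA; have [bA A0] := jA; have [bB _] := JB.
have jB := isJ_jordan JB.
have An0 : A !=set0 by case: iA => x /interior_subset; exists x.
have pA := bounded_proper An0 bA.
have [M1 M10 far1] := dS_far pA bA.
rewrite /avg1; case: asboolP => [zmc|nz].
  have {}zmc : zero_measure_cond A B by case: zmc.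
  have [BE|/set0P Bn0] := eqVneq B set0.
    have dE g : davg g A B = [set p | 0 <=
        blend (fun p => dS p A) (fun p => - enorm (p - center A)) g p].
      by rewrite /davg BE (davg_fun_blend0 _ An0).
    have -> : hAB A B = fun g => leb [set p | 0 <=
        blend (fun p => dS p A) (fun p => - enorm (p - center A)) g p].
      by apply/funext => g; rewrite /hAB dE.
    rewrite dE.
    have [cA dc] := centerP bA iA.
    apply: (@blend_avg A B (bdry A) [set center A] _ _ (M1 + enorm (center A))) => //.
    - exact: bdry_nonempty.
    - by exists (center A).
    - by move=> p; exact: dS_abs.
    - by move=> p; rewrite normrN ger0_norm ?enorm_ge0// edist_set1.
    - exact: dS_lip1.
    - by move=> p q; have := enorm_tri p q (center A); rewrite (enormB q p); lra.
    (* The signed distance is positive at the center and 1-Lipschitz, so it dominates minus the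
       distance to the center. *)
    - move=> p; have := dS_lip (center A) p pA; rewrite (enormB p); lra.
    - by move=> p Mp; have := enorm_ge0 (center A); have := far1 p; lra.
    - move=> p Mp; have := enormD (p - center A) (center A).
      rewrite subrK; have := enormD p (- center A); rewrite enormN ler_norml.
      by move=> *; apply/andP; split; lra.
    - exact: dS_eq0_leb0.
    - apply: (sub_leb0 _ (leb_pt (center A))) => p /= /eqP.
      by rewrite oppr_eq0 => /eqP/enorm_eq0/eqP; rewrite subr_eq0 => /eqP.
    - exact: dS_pos.
    - exact: dS_pos_leb0.
    - by rewrite BE.
    - apply: (sub_leb0 _ (leb_pt (center A))) => p [/= + _].
      have := enorm_ge0 (p - center A) => ? ?.
      have /enorm_eq0/eqP : enorm (p - center A) = 0 by lra.
      by rewrite subr_eq0 => /eqP.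
    - by move: zmc; rewrite /zero_measure_cond BE (davg_fun_blend0 _ An0).
  have pB := bounded_proper Bn0 bB.
  have [M2 M20 far2] := dS_far pB bB.
  have dE g : davg g A B = [set p | 0 <=
      blend (fun p => dS p A) (fun p => dS p B) g p].
    by rewrite /davg (davg_fun_blend _ An0 Bn0).
  have -> : hAB A B = fun g => leb [set p | 0 <=
      blend (fun p => dS p A) (fun p => dS p B) g p].
    by apply/funext => g; rewrite /hAB dE.
  rewrite dE.
  apply: (@blend_avg A B (bdry A) (bdry B) _ _ (M1 + M2)) => //.
  - exact: bdry_nonempty.
  - exact: bdry_nonempty.
  - by move=> p; exact: dS_abs.
  - by move=> p; exact: dS_abs.
  - exact: dS_lip1.
  - exact: dS_lip1.
  - by move=> p; exact: dS_mono.
  - by move=> p Mp; have := far1 p; lra.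
  - by move=> p Mp; have := far2 p; lra.
  - exact: dS_eq0_leb0.
  - exact: dS_eq0_leb0.
  - exact: dS_pos.
  - exact: dS_pos_leb0.
  - exact: dS_pos.
  - exact: dS_pos_leb0.
  - by move: zmc; rewrite /zero_measure_cond (davg_fun_blend _ An0 Bn0).
(* Here the zero-measure condition fails, which it cannot do for empty [B]. *)
have Bn0 : B !=set0.
  apply/set0P/eqP => BE; apply: nz; left; rewrite BE.
  exact: zero_measure_cond_set0.
rewrite -/(meas A) -/(meas B); set tg := t * _ + _.
have BAm : meas B <= meas A by exact: le_meas.
have [r1 r10 Wr1] : exists2 r, 0 <= r & meas (Onbhd B r `&` A) = tg.
  by apply: onbhd_ivt => //; case/andP: t01 => t0 t1; apply/andP; split; rewrite /tg; nra.
set P := [set r | _].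
have bO r : bounded_pt (Onbhd B r `&` A) by apply: bounded_sub bA => p [].
have [r0] : P (xget 0 P) by apply: (@xgetI _ 0 P r1); split => //; rewrite measE ?Wr1.
move: (xget 0 P) r0 => r r0; rewrite measE// => -[Wr].
apply: is_avg_ci => //.
- have cl : Onbhd B r = [set p | 0 <= r - edist p B].
    by apply/funext => p; rewrite /Onbhd /= subr_ge0.
  split => //; apply: (sub_leb0 (@bdryI _ _ _ _)); apply: leb0U => //.
  have [->|rn0] := eqVneq r 0.
    suff -> : Onbhd B 0 = B by case: jB.
    apply/seteqP; split => p; rewrite /Onbhd /=.
      by move/(edist_eq0 Bn0); rewrite -(closure_id B).1//; exact: isJ_closed.
    by move=> Bp; rewrite edist_closure//; exact: subset_closure.
  have rp : 0 < r by rewrite lt_def rn0.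
  apply: (sub_leb0 _ (sphere_leb0 Bn0 rp)); rewrite cl => p.
  move/(@bdry_ge0 1 _ ltr01) => /=; rewrite /lip => H.
  have /eqP : r - edist p B = 0 by apply: H => p' q; have := onbhd_lip Bn0 p' q; lra.
  by rewrite subr_eq0 => /eqP.
- apply: setD_leb0_sub => p Bp; split; last exact: BA.
  by rewrite /Onbhd/= edist_closure//; exact: subset_closure.
- by apply: setD_leb0_sub => p [].
Qed.

End Interpolation.

(** * Measure averages of general pairs *)

Section Components.
Variables (R : realType) (n : nat).
Local Notation pt := 'rV[R]_n.+1.
Implicit Types (A B C D E S X : set pt) (p q y z : pt) (s : seq (set pt)).

Lemma connected_enorm_ball p (e : R) : 0 < e -> connected [set q | enorm (p - q) < e].
Proof.
move=> e0.
pose seg q := [set p + t *: (q - p) | t in `[(0 : R), 1]].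
have pseg q : seg q p.
  by exists 0; [rewrite /= in_itv/= lexx ler01|rewrite scale0r addr0].
have -> : [set q | enorm (p - q) < e] =
    \bigcup_(q in [set q | enorm (p - q) < e]) seg q.
  apply/seteqP; split=> [q pq|_ [q /= pq [t + <-]]].
    exists q => //; exists 1; first by rewrite /= in_itv/= lexx ler01.
    by rewrite scale1r addrC subrK.
  rewrite /= in_itv/= => /andP[t0 t1].
  rewrite opprD addrA subrr add0r enormN enormZ ger0_norm// enormB.
  by apply: le_lt_trans pq; rewrite ler_piMl ?enorm_ge0.
apply: bigcup_connected; first by exists p => q _.
move=> q _; apply: connected_continuous_connected; first exact: segment_connected.
apply: continuous_subspaceT => t.
by apply: cvgD; [exact: cvg_cst|exact: scalel_continuous].
Qed.

Section Pair.
Variables A B : set pt.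
Hypotheses (JA : isJ A) (JB : isJ B).

(** A small ball around [x] lies in the difference because [B] is closed; being connected, it stays
    in the component of [x]. *)
Lemma component_interior p x : connected_component (A `\` B) p x ->
  interior A x -> interior (connected_component (A `\` B) p) x.
Proof.
move=> px iA.
have Bx : ~ B x by case: (connected_component_sub px).
have : nbhs x (A `&` ~` B).
  apply: filterI => //; apply: open_nbhs_nbhs; split => //.
  exact: closed_openC (isJ_closed JB).
move/nbhs_enormP => [e e0 eAB]; apply/nbhs_enormP; exists e => // q xq.
rewrite (same_connected_component px).
have H : [set q | enorm (x - q) < e] `<=` connected_component (A `\` B) x.
  apply: connected_component_max; last exact: connected_enorm_ball.
    by rewrite /= subrr enorm0.
  by move=> z /eAB.
exact: H.
Qed.

Lemma component_closure p :
  closure (connected_component (A `\` B) p) `<=` connected_component (A `\` B) p `|` B.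
Proof.
set C := connected_component _ p => x cx.
have [Bx|Bx] := pselect (B x); [by right|left].
have CAB : C `<=` A `\` B by exact: connected_component_sub.
have Ax : A x.
  rewrite (closure_id A).1; last exact: isJ_closed.
  by move: cx; apply: closureS => z /CAB[].
have [y Cy] : C !=set0 by apply/set0P/eqP => C0; move: cx; rewrite C0 closure0.
have sub : C `|` [set x] `<=` A `\` B by move=> z [/CAB//|->].
(* In a separation of this set the connected [C] lies on one side, so the other side is the point
   [x], which is in the closure of [C]. *)
have con : connected (C `|` [set x]).
  have cC := @component_connected _ (A `\` B) p.
  apply/connectedP => E [E0 EU sE].
  have [] := connected_subset sE (_ : C `<=` _) cC.
  - by rewrite -EU; exact: subsetUl.
  - move=> CE; have [z Ez] := E0 true.
    have : (C `|` [set x]) z by rewrite EU; right.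
    case=> [/CE Ez'|zx].
      by have := separated_disjoint sE; apply/eqP/set0P; exists z.
    have [H _] := sE; suff : set0 z by []; rewrite -H; split => //.
    by rewrite zx; exact: closureS cx.
  - move=> CE; have [z Ez] := E0 false.
    have : (C `|` [set x]) z by rewrite EU; left.
    case=> [/CE Ez'|zx].
      by have := separated_disjoint sE; apply/eqP/set0P; exists z.
    have [_ H] := sE; suff : set0 z by []; rewrite -H; split => //.
    by rewrite zx; exact: closureS cx.
have py : connected_component (A `\` B) p y by [].
rewrite /C (same_connected_component py).
by apply: (connected_component_max _ sub con); [left|right].
Qed.

(** The boundary lies in the boundaries of [A] and [B]: a boundary point in the component cannot be
    interior to [A], and one in [B] is a limit of points outside [B]. *)
Lemma component_jordan p : jordan (connected_component (A `\` B) p).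
Proof.
have sub := @connected_component_sub _ (A `\` B) p.
split; first by apply: bounded_sub JA.1 => x /sub[].
have A0 := JA.2.2; have B0 := JB.2.2.
apply: (sub_leb0 _ (leb0U A0 B0)) => x [cx ix].
have [Cx|Bx] := component_closure cx.
  left; split; first by apply: subset_closure; case: (sub x Cx).
  by move=> iA; apply: ix; exact: component_interior.
right; split; first exact: subset_closure.
move=> iB; have [y [/sub[_ By] /interior_subset]] := cx _ (nbhs_interior iB).
exact: By.
Qed.

Lemma componentsP C : components A B C ->
  [/\ C `<=` A `\` B, jordan C, C !=set0 &
      forall x, C x -> C = connected_component (A `\` B) x].
Proof.
move=> [p [ABp ->]]; split.
- exact: connected_component_sub.
- exact: component_jordan.
- by exists p; exact: connected_component_refl.
- by move=> x; exact: same_connected_component.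
Qed.

Lemma components_disjoint C D x : components A B C -> components A B D ->
  C x -> D x -> C = D.
Proof.
move=> /componentsP[_ _ _ CP] /componentsP[_ _ _ DP] Cx Dx.
by rewrite (CP x Cx) (DP x Dx).
Qed.

Lemma components_cover x : (A `\` B) x -> exists2 C, components A B C & C x.
Proof.
move=> ABx; exists (connected_component (A `\` B) x).
  by exists x.
exact: connected_component_refl.
Qed.

(* Points of the interior of [A] accumulate at [x] and can avoid the closed set
   formed by [B] and finitely many components. *)
Lemma avoid_components (F : set (set pt)) x : finite_set F -> F `<=` components A B ->
  (A `\` B) x -> ~ (\bigcup_(C in F) C) x ->
  exists y, [/\ interior A y, (A `\` B) y & ~ (\bigcup_(C in F) C) y].
Proof.
move=> finF FC [Ax Bx] Fx.
have cl : closed (B `|` \bigcup_(C in F) closure C).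
  apply: closedU; first exact: isJ_closed.
  by apply: (@closed_bigcup _ (set pt)) => // C _; exact: closed_closure.
have xK : ~ (B `|` \bigcup_(C in F) closure C) x.
  move=> [//|[C FCC cx]]; have [p [_ CE]] := FC C FCC.
  move: cx; rewrite CE => /component_closure[Cx|//].
  by apply: Fx; exists C => //; rewrite CE.
have : nbhs x (~` (B `|` \bigcup_(C in F) closure C)).
  by apply: open_nbhs_nbhs; split => //; exact: closed_openC.
move: Ax; rewrite {1}JA.2.1 => /[apply] -[y [iy Ky]].
exists y; split => //.
  by split; [exact: interior_subset|move=> By; apply: Ky; left].
by move=> [C FCC Cy]; apply: Ky; right; exists C => //; exact: subset_closure.
Qed.

Lemma bigcup_cons (F : set pt -> set pt) C s :
  \bigcup_(D in [set` C :: s]) F D = F C `|` \bigcup_(D in [set` s]) F D.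
Proof.
apply/seteqP; split=> x.
  move=> [D /=]; rewrite inE => /predU1P[->|Ds] FD; [by left|by right; exists D].
move=> [FC|[D /= Ds FD]]; first by exists C => //=; rewrite inE eqxx.
by exists D => //=; rewrite inE Ds orbT.
Qed.

Definition disjoint_seq s := forall C D x, C \in s -> D \in s -> C x -> D x -> C = D.

Lemma disjoint_tail C s : disjoint_seq (C :: s) -> disjoint_seq s.
Proof. by move=> dS D E x Ds Es; apply: dS; rewrite inE ?Ds ?Es orbT. Qed.

Lemma jordan_bigcup s : (forall C, C \in s -> jordan C) ->
  jordan (\bigcup_(C in [set` s]) C).
Proof.
elim: s => [_|C s IH js].
  rewrite (_ : [set` [::]] = set0) ?bigcup_set0; first exact: isJ_jordan (isJ0 _ _).
  by apply/seteqP; split => x.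
rewrite bigcup_cons; apply: jordanU; first by apply: js; rewrite inE eqxx.
by apply: IH => D Ds; apply: js; rewrite inE Ds orbT.
Qed.

Lemma meas_bigcup_cons C s : uniq (C :: s) -> disjoint_seq (C :: s) ->
  (forall D, D \in C :: s -> jordan D) ->
  meas (\bigcup_(D in [set` C :: s]) D) = meas C + meas (\bigcup_(D in [set` s]) D).
Proof.
move=> /= /andP[Cs us] dS js.
have jC : jordan C by apply: js; rewrite inE eqxx.
have jU := jordan_bigcup js; rewrite (meas_splitID jU.1 (jordan_leb_measurable jC)) bigcup_cons.
congr (_ + _); congr meas; first by rewrite setIC setIUr setIid; apply/setUidl; exact: subIsetl.
apply/seteqP; split => x; first by move=> [[//|//]].
move=> [D /= Ds Dx]; split; first by right; exists D.
move=> Cx; move/negP: Cs; apply.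
by rewrite (dS C D x) ?inE ?eqxx ?Ds ?orbT.
Qed.

(** Disjoint sets of measure at least [eps] inside the bounded set [A] number at most
    [meas A / eps]. *)
Lemma finite_large_components (eps : R) : 0 < eps ->
  finite_set [set C | components A B C /\ (eps%:E <= leb C)%E].
Proof.
move=> e0; apply: contrapT => /infinite_set_fset H.
have [F FC Fn] := H (Num.bound (meas A / eps)).
pose s : seq (set pt) := finmap.enum_fset F.
have sC C : C \in s -> components A B C /\ (eps%:E <= leb C)%E by exact: FC.
have us : uniq s by exact: finmap.fset_uniq.
have sub : \bigcup_(C in [set` s]) C `<=` A.
  by move=> x [C /= /sC[/componentsP[sC' _ _ _] _] /sC'[]].
have dS : disjoint_seq s.
  by move=> C D x /sC[hC _] /sC[hD _]; exact: components_disjoint.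
have key : (size s)%:R * eps <= meas (\bigcup_(C in [set` s]) C).
  elim: (s) sC us dS => [|C r IH] rC /= ur dr; first by rewrite mul0r meas_ge0.
  rewrite meas_bigcup_cons//; last by move=> D /rC[/componentsP[]].
  rewrite -natr1 mulrDl mul1r addrC lerD//.
    have [/componentsP[_ [bC _] _ _]] : components A B C /\ (eps%:E <= leb C)%E.
      by apply: rC; rewrite inE eqxx.
    by rewrite measE// lee_fin.
  apply: IH; last exact: disjoint_tail dr.
    by move=> D Dr; apply: rC; rewrite inE Dr orbT.
  by case/andP: ur.
have : (size s)%:R * eps <= meas A by apply: (le_trans key); exact: le_meas JA.1 sub.
rewrite -ler_pdivlMr// leNgt => /negP; apply.
apply: (lt_le_trans (archi_boundP _)); last by rewrite ler_nat.
by rewrite divr_ge0 ?meas_ge0 ?ltW.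
Qed.

Variable eps : R.
Hypotheses (e0 : 0 < eps) (BA : B `<=` A) (AB : A <> B).

Lemma pair_nonempty : (A `\` B) !=set0.
Proof.
apply: contrapT => /nonemptyPn; rewrite setD_eq0 => sub.
by apply: AB; apply/seteqP.
Qed.

(** What the averages need to know about the pieces, whether or not small components were merged. *)
Lemma comp_familyP :
  [/\ finite_set (comp_family eps A B),
      forall C, comp_family eps A B C ->
        [/\ jordan C, C `<=` A `\` B & interior C !=set0],
      forall C D x, comp_family eps A B C -> comp_family eps A B D ->
        C x -> D x -> C = D &
      \bigcup_(C in comp_family eps A B) C = A `\` B].
Proof.
rewrite /comp_family; case: asboolP => [fin|inf].
  split => //.
  - move=> C cC; have [sC jC [x Cx] CP] := componentsP cC; split => //.
    (* A point interior to [A] that avoids [B] and the finitely many other components must be an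
       interior point of [C]. *)
    have [||||y [iA ABy yF]] := @avoid_components (components A B `\ C) x.
    + exact: finite_setD.
    + by move=> D [].
    + exact: sC.
    + by move=> [D [cD DC] Dx]; apply: DC; exact: components_disjoint cD cC Dx Cx.
    exists y; have [D cD Dy] := components_cover ABy.
    have DC : D = C by apply: contrapT => DC; apply: yF; exists D.
    subst D; have [p [_ CE]] := cC; rewrite CE in Dy *.
    exact: component_interior.
  - by move=> C D x; exact: components_disjoint.
  - apply/seteqP; split => x.
      by move=> [C /componentsP[sC _ _ _] /sC].
    by move=> /components_cover[C cC Cx]; exists C.
set L := [set C | components A B C /\ (eps%:E <= leb C)%E].
set S := [set C | components A B C /\ (leb C < eps%:E)%E].
set U := \bigcup_(C in S) C.
have finL : finite_set L by exact: finite_large_components.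
have LS C : components A B C -> L C \/ S C.
  by move=> cC; have [h|h] := leP eps%:E (leb C); [left|right].
(* In this form [U] involves finitely many components only, which gives it a null boundary although
   it is an infinite union. *)
have UE : U = (A `\` B) `\` \bigcup_(C in L) C.
  apply/seteqP; split => x.
    move=> [C [cC ltC] Cx]; have [sC _ _ _] := componentsP cC.
    split; first exact: sC.
    move=> [D [cD leD] Dx]; move: ltC.
    by rewrite (components_disjoint cC cD Cx Dx) ltNge leD.
  move=> [/components_cover[C cC Cx] Lx]; exists C => //.
  by have [LC|//] := LS C cC; case: Lx; exists C.
have LP C : L C -> [/\ jordan C, C `<=` A `\` B & interior C !=set0].
  move=> [cC leC]; have [sC jC _ CP] := componentsP cC; split => //.
  apply: contrapT => /nonemptyPn iC; move: leC; rewrite leNgt => /negP; apply.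
  suff -> : leb C = 0%E by rewrite lte_fin.
  by apply: (sub_leb0 _ jC.2) => x Cx; split; [exact: subset_closure|rewrite iC].
have jU : jordan U.
  rewrite UE; apply: jordanD; first by apply: jordanD; exact: isJ_jordan.
  have [s sE] := (finite_seqP _).1 finL.
  rewrite sE; apply: jordan_bigcup => C Cs.
  by have [] := LP C; rewrite // sE.
have iU : interior U !=set0.
  have [x Ux] : U !=set0.
    have [C [cC LC]] : (components A B `\` L) !=set0.
      by apply: infinite_setN0; exact: infinite_setD.
    have [_ _ [x Cx] _] := componentsP cC.
    by exists x, C => //; case: (LS C cC).
  rewrite UE in Ux; have [ABx Lx] := Ux.
  have [||||y [iA ABy yL]] := @avoid_components L x => //; first by move=> C [].
  exists y; have [C cC Cy] := components_cover ABy.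
  have SC : S C by have [LC|//] := LS C cC; case: yL; exists C.
  have [p [_ CE]] := cC; rewrite CE in Cy.
  have := component_interior Cy iA; rewrite -CE; apply: filterS => z Cz.
  by exists C.
have disjLU C x : L C -> C x -> U x -> False.
  by move=> LC Cx; rewrite UE => -[_]; apply; exists C.
split.
- by rewrite finite_setU; split => //; exact: finite_set1.
- move=> C [/LP//|->]; split => //.
  by rewrite UE; exact: subDsetl.
- move=> C D x [LC|->] [LD|->] Cx Dx => //.
  + exact: components_disjoint LC.1 LD.1 Cx Dx.
  + by case: (disjLU C x LC Cx Dx).
  + by case: (disjLU D x LD Dx Cx).
- rewrite bigcup_setU bigcup_set1 UE; apply/seteqP; split => x.
    by move=> [[C /LP[_ sC _] /sC]|[]].
  move=> ABx; have [Lx|Lx] := pselect ((\bigcup_(C in L) C) x); first by left.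
  by right.
Qed.

(** The measure of the union of the pieces is additive by disjointness, whereas what is added to [B]
    and what is missed are subadditive, so the bounds for single pieces sum up. *)
Lemma avg2_seq t (F : set pt -> set pt) s : 0 <= t <= 1 -> uniq s -> disjoint_seq s ->
  (forall C, C \in s -> [/\ jordan C, C `<=` A `\` B & is_avg t (B `|` C) B (F C)]) ->
  let U := \bigcup_(C in [set` s]) C in
  let T := \bigcup_(C in [set` s]) F C in
  [/\ isJ T, jordan U, leb (T `\` (B `|` U)) = 0%E,
      meas (T `\` B) <= t * meas U & meas (U `\` T) <= (1 - t) * meas U].
Proof.
move=> /andP[t0 t1]; elim: s => [|C s IH] us dS Hs.
  rewrite (_ : [set` [::]] = set0) /=; last by apply/seteqP; split => x.
  rewrite !bigcup_set0 !set0D meas_eq0 ?leb_set0// !mulr0; split => //.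
    exact: isJ0.
  exact: isJ_jordan (isJ0 _ _).
have jS D : D \in C :: s -> jordan D by case/Hs.
have [||jT jU TU Tt Ut] := IH _ (disjoint_tail dS).
- by case/andP: us.
- by move=> D Ds; apply: Hs; rewrite inE Ds orbT.
have [jC CAB [JF BF FC Ft Ct]] := Hs C (mem_head _ _).
rewrite /= (meas_bigcup_cons us dS jS) !bigcup_cons.
move: (\bigcup_(D in [set` s]) F D) (\bigcup_(D in [set` s]) D) jT jU TU Tt Ut => T U jT jU TU Tt Ut.
have BCB : (B `|` C) `\` B = C.
  apply/seteqP; split => x; first by move=> [[]].
  by move=> Cx; split; [right|case: (CAB x Cx)].
rewrite BCB in Ft Ct.
have bD X Y : bounded_pt X -> bounded_pt (X `\` Y) by apply: bounded_sub => x [].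
have [[[bF bT] bU] bC] := (JF.1, jT.1, jU.1, jC.1).
split.
- exact: isJU.
- exact: jordanU.
- apply: (sub_leb0 _ (leb0U FC TU)) => x [[Fx|Tx] H]; [left|right]; split => //.
    by move=> [Bx|Cx]; apply: H; [left|right; left].
  by move=> [Bx|Ux]; apply: H; [left|right; right].
- rewrite mulrDr; apply: le_trans (lerD Ft Tt); rewrite setDUl.
  by apply: measU; exact: bD.
- rewrite mulrDr; apply: le_trans (lerD _ Ut); last exact: Ct.
  have bBC : bounded_pt ((B `|` C) `\` F C) by apply/bD/bounded_setU => //; exact: JB.1.
  apply: (le_measU bBC (bD U T bU)) => x [[Cx|Ux] H].
    by left; split; [right|move=> Fx; apply: H; left].
  by right; split => // Tx; apply: H; right.
Qed.

Lemma avg2_spec N t : 1 <= N -> 0 <= t <= 1 -> is_avg t A B (avg2 N eps t A B).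
Proof.
move=> N1 t01; have [t0 t1] : 0 <= t /\ t <= 1 by case/andP: t01.
rewrite /avg2 asboolT//.
have [fin famP fdisj fU] := comp_familyP.
have [s0 sE0] := (finite_seqP _).1 fin.
pose s := undup s0; have sE : comp_family eps A B = [set` s].
  by rewrite sE0; apply/seteqP; split => C /=; rewrite mem_undup.
have inF C : C \in s -> comp_family eps A B C by rewrite sE.
have avgC C : comp_family eps A B C -> is_avg t (B `|` C) B (avg1 N t (B `|` C) B).
  move=> /famP[jC sC [x iC]]; apply: avg1_spec => //.
  - by apply: jordanU => //; exact: isJ_jordan.
  - by exists x; move: iC; apply: filterS; exact: subsetUr.
have [|||jT jU TU Tt Ut] := @avg2_seq t (fun C => avg1 N t (B `|` C) B) s t01.
- exact: undup_uniq.
- by move=> C D x /inF hC /inF hD; exact: fdisj.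
- by move=> C /inF hC; have [jC sC _] := famP C hC; split => //; exact: avgC.
rewrite -sE fU in jT jU TU Tt Ut.
set T := \bigcup_(C in _) _.
have {jT TU Tt Ut} [JT TU Tt Ut] : [/\ isJ T, leb (T `\` (B `|` (A `\` B))) = 0%E,
    meas (T `\` B) <= t * meas (A `\` B) &
    meas ((A `\` B) `\` T) <= (1 - t) * meas (A `\` B)] by [].
have supT C : comp_family eps A B C -> avg1 N t (B `|` C) B `<=` T.
  by move=> hC x Fx; exists C.
have BAB : B `|` A `\` B = A by rewrite setDE setUIr setUCr setIT; exact/setUidr.
rewrite BAB in TU.
(* [T] contains [B] up to a null set only because there is at least one piece, which is where
   [A <> B] enters. *)
have BT : leb (B `\` T) = 0%E.
  have [x ABx] := pair_nonempty; rewrite -fU in ABx; have [C hC _] := ABx.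
  have [_ BF _ _ _] := avgC C hC.
  by apply: (sub_leb0 _ BF) => y [By Ty]; split => // /(supT C hC).
split => //; apply: (le_trans _ Ut).
rewrite -[leRHS]add0r -(meas_eq0 BT); apply: le_measU.
- by apply: bounded_sub JB.1 => x [].
- by apply: bounded_sub JA.1 => x [[]].
- move=> x [Ax Tx]; have [Bx|Bx] := pselect (B x); [by left|by right].
Qed.

End Pair.

Lemma avg2e_spec (eps N t : R) A B : isJ A -> isJ B -> B `<=` A -> 0 < eps -> 1 <= N ->
  0 <= t <= 1 -> is_avg t A B (avg2e N eps t A B).
Proof.
move=> JA JB BA e0 N1 t01; rewrite /avg2e; case: asboolP => [<-|AB].
  by split => //; rewrite setDv ?leb_set0// meas_eq0 ?leb_set0// mulr0.
exact: avg2_spec.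
Qed.

(** * The distance of bounded sets as a real number *)

Definition sdist A B : R := meas (symdiff A B).

Lemma symdiffC A B : symdiff A B = symdiff B A.
Proof. exact: setUC. Qed.

Lemma sdistC A B : sdist A B = sdist B A.
Proof. by rewrite /sdist symdiffC. Qed.

Lemma bounded_symdiff A B : bounded_pt A -> bounded_pt B -> bounded_pt (symdiff A B).
Proof.
by move=> bA bB; apply: bounded_sub (bounded_setU bA bB) => x [[Ax _]|[Bx _]]; [left|right].
Qed.

Lemma symdiff_tri B A C : symdiff A C `<=` symdiff A B `|` symdiff B C.
Proof.
move=> x [[Ax Cx]|[Cx Ax]]; have [Bx|Bx] := pselect (B x).
- by right; left.
- by left; left.
- by left; right.
- by right; right.
Qed.

Lemma sdist_tri B A C : bounded_pt A -> bounded_pt B -> bounded_pt C ->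
  sdist A C <= sdist A B + sdist B C.
Proof.
by move=> bA bB bC; apply: le_measU; [exact: bounded_symdiff..|exact: symdiff_tri].
Qed.

Lemma sdistE A B : bounded_pt A -> bounded_pt B -> leb_measurable A ->
  sdist A B = meas (A `\` B) + meas (B `\` A).
Proof.
move=> bA bB mA; rewrite /sdist (meas_splitID (bounded_symdiff bA bB) mA).
congr (_ + _); congr meas; apply/seteqP; split => x.
- by move=> [[[]|[]]].
- by move=> [Ax Bx]; split => //; left.
- by move=> [[[]|[]]].
- by move=> [Ax Bx]; split => //; right.
Qed.

Lemma sdist_le A B : bounded_pt A -> bounded_pt B ->
  sdist A B <= meas (A `\` B) + meas (B `\` A).
Proof.
by move=> bA bB; apply: measU; [apply: bounded_sub bA => x []|apply: bounded_sub bB => x []].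
Qed.

Lemma is_avg_sdist t A B S : isJ A -> isJ B -> B `<=` A -> is_avg t A B S ->
  sdist S A <= (1 - t) * sdist A B /\ sdist S B <= t * sdist A B.
Proof.
move=> JA JB BA [JS BS SA St At].
have [[bA bB] bS] := (JA.1, JB.1, JS.1).
rewrite (sdistE bA bB (isJ_leb_measurable JA)) (meas_eq0 (setD_leb0_sub BA)) addr0.
split; apply: (le_trans (sdist_le _ _)) => //.
  by rewrite (meas_eq0 SA) add0r.
by rewrite (meas_eq0 BS) addr0.
Qed.

(** For a general pair, the part of the average outside [A] comes from the average of [B] with the
    core [I], and the part of [A] missed is missed by the average of [A] with [I]. Both carry the
    factor [1 - t], on [B] minus [I] and on [A] minus [I]; the distance to [B] is symmetric with
    factor [t]. *)
Lemma mavg_spec (N eps t : R) A B : 1 <= N -> 0 < eps -> 0 <= t <= 1 ->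
  isJ A -> isJ B -> let M := mavg N eps t A B in
  [/\ isJ M, sdist M A <= (1 - t) * sdist A B & sdist M B <= t * sdist A B].
Proof.
move=> N1 e0 t01 JA JB; have [t0 t1] : 0 <= t /\ t <= 1 by case/andP: t01.
have t01' : 0 <= 1 - t <= 1 by apply/andP; split; lra.
have [bA bB] := (JA.1, JB.1).
rewrite /mavg; case: asboolP => [<-|AB].
  have -> : sdist A A = 0 by rewrite /sdist /symdiff setDv setU0 meas_eq0// leb_set0.
  by rewrite !mulr0.
case: asboolP => [BA|nBA].
  have S := avg2_spec JA JB e0 BA AB N1 t01.
  by have [? ?] := is_avg_sdist JA JB BA S; split => //; case: S.
case: asboolP => [sAB|nAB].
  have S := avg2_spec JB JA e0 sAB (nesym AB) N1 t01'.
  have [] := is_avg_sdist JB JA sAB S; rewrite subKr (sdistC B A).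
  by split => //; case: S.
rewrite asboolT//; set I := ci (A `&` B).
have jI := jordanI (isJ_jordan JA) (isJ_jordan JB).
have JI : isJ I by exact: jordan_ci.
have IA : I `<=` A.
  rewrite JA.2.1; apply: closureS; apply: interiorS; exact: subIsetl.
have IB : I `<=` B.
  rewrite JB.2.1; apply: closureS; apply: interiorS; exact: subIsetr.
have [J1 I1 S1 h1 k1] := avg2e_spec JA JI IA e0 N1 t01.
have [J2 I2 S2 h2 k2] := avg2e_spec JB JI IB e0 N1 t01'.
move: (avg2e N eps t A I) (avg2e N eps (1 - t) B I) J1 I1 S1 h1 k1 J2 I2 S2 h2 k2.
move=> R1 R2 J1 I1 S1 h1 k1 J2 I2 S2 h2 k2.
have bD X Y : bounded_pt X -> bounded_pt (X `\` Y) by apply: bounded_sub => x [].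
have [b1 b2] := (J1.1, J2.1).
have JM := isJU J1 J2.
have nI := leb_Dci jI; rewrite -/I in nI.
have bI : bounded_pt (A `&` B) by exact: jI.1.
(* Replacing the intersection by its core [I] costs only a null set. *)
have AI : meas (A `\` I) <= meas (A `\` B).
  rewrite -[leRHS]addr0 -(meas_eq0 nI); apply: le_measU; [exact: bD..|].
  by move=> x [Ax Ix]; have [Bx|Bx] := pselect (B x); [right|left].
have BI : meas (B `\` I) <= meas (B `\` A).
  rewrite -[leRHS]addr0 -(meas_eq0 nI); apply: le_measU; [exact: bD..|].
  by move=> x [Bx Ix]; have [Ax|Ax] := pselect (A x); [right|left].
have MA : meas ((R1 `|` R2) `\` A) <= meas (R2 `\` I).
  rewrite -[leRHS]add0r -(meas_eq0 S1); apply: le_measU; [exact: bD..|].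
  move=> x [[Rx|Rx] Ax]; first by left.
  by right; split => // /IA.
have MB : meas ((R1 `|` R2) `\` B) <= meas (R1 `\` I).
  rewrite -[leRHS]addr0 -(meas_eq0 S2); apply: le_measU; [exact: bD..|].
  move=> x [[Rx|Rx] Bx]; last by right.
  by left; split => // /IB.
have AM : meas (A `\` (R1 `|` R2)) <= meas (A `\` R1).
  by apply: le_meas => [|x [Ax H]]; [exact: bD|split => // Rx; apply: H; left].
have BM : meas (B `\` (R1 `|` R2)) <= meas (B `\` R2).
  by apply: le_meas => [|x [Bx H]]; [exact: bD|split => // Rx; apply: H; right].
have sE := sdistE bA bB (isJ_leb_measurable JA).
rewrite subKr in k2.
have bM := JM.1.
have a1 : (1 - t) * meas (A `\` I) <= (1 - t) * meas (A `\` B) by rewrite ler_wpM2l// subr_ge0.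
have a2 : t * meas (A `\` I) <= t * meas (A `\` B) by rewrite ler_wpM2l.
have a3 : (1 - t) * meas (B `\` I) <= (1 - t) * meas (B `\` A) by rewrite ler_wpM2l// subr_ge0.
have a4 : t * meas (B `\` I) <= t * meas (B `\` A) by rewrite ler_wpM2l.
split => //; apply: (le_trans (sdist_le _ _)) => //; rewrite sE; lra.
Qed.

End Components.

(** * The spline scheme *)

Section Scheme.
Variables (R : realType) (n : nat) (N eps : R).
Hypotheses (N1 : 1 <= N) (eps0 : 0 < eps).
Local Notation pt := 'rV[R]_n.+1.
Implicit Types (A B C : set pt) (F : int -> set pt) (D : R) (i j : int).

Definition slow D F :=
  (forall i, isJ (F i)) /\ (forall i, sdist (F i) (F (i + 1)) <= D).

Lemma sdistAA A : sdist A A = 0.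
Proof. by rewrite /sdist /symdiff setDv setU0 meas_eq0// leb_set0. Qed.

Lemma isJ_sdist_tri B A C : isJ A -> isJ B -> isJ C ->
  sdist A C <= sdist A B + sdist B C.
Proof. by move=> [bA _] [bB _] [bC _]; exact: sdist_tri. Qed.

Lemma half_mavg D A B : isJ A -> isJ B -> sdist A B <= D ->
  let M := mavg N eps 2^-1 A B in
  [/\ isJ M, sdist M A <= D / 2 & sdist M B <= D / 2].
Proof.
move=> JA JB ABD; have h : 0 <= (2^-1 : R) <= 1 by apply/andP; split; lra.
by have [JM MA MB] := mavg_spec N1 eps0 h JA JB; split => //; lra.
Qed.

Lemma refine0_slow D F : slow D F ->
  slow (D / 2) (refine0 N eps F) /\
  forall j, sdist (refine0 N eps F j) (F (j %/ 2)%Z) <= D / 2.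
Proof.
move=> [JF FD]; have mid i := half_mavg (JF i) (JF (i + 1)) (FD i).
have D0 : 0 <= D by apply: le_trans (FD 0); exact: meas_ge0.
split; first split.
- move=> j; rewrite /refine0; case: ifP => _; first exact: (JF (j %/ 2)%Z).
  by have [] := mid (j %/ 2)%Z.
- move=> j; rewrite /refine0; case: ifPn => j2.
    have [-> /eqP/negbTE ->] : ((j + 1) %/ 2)%Z = (j %/ 2)%Z /\ ((j + 1) %% 2)%Z <> 0 by lia.
    by rewrite sdistC; case: (mid (j %/ 2)%Z).
  have [-> ->] : ((j + 1) %/ 2)%Z = (j %/ 2)%Z + 1 /\ ((j + 1) %% 2)%Z = 0 by lia.
  by rewrite eqxx; case: (mid (j %/ 2)%Z).
- move=> j; rewrite /refine0; case: ifP => _; last by case: (mid (j %/ 2)%Z).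
  by rewrite sdistAA divr_ge0.
Qed.

(** Consecutive averages are both within [D / 2] of the set [F (j + 1)] they share, so smoothing
    keeps the bound that refinement has halved. *)
Lemma avgstep_slow D F : slow D F ->
  slow D (avgstep N eps F) /\ forall j, sdist (avgstep N eps F j) (F j) <= D / 2.
Proof.
move=> [JF FD]; have mid i := half_mavg (JF i) (JF (i + 1)) (FD i).
split; last by move=> j; case: (mid j).
split=> [j|j]; first by case: (mid j).
have [J1 _ h1] := mid j; have [J2 h2 _] := mid (j + 1).
rewrite sdistC in h2; rewrite /avgstep (splitr D).
exact: le_trans (isJ_sdist_tri J1 (JF (j + 1)) J2) (lerD h1 h2).
Qed.

Lemma iter_avgstep_slow D F q : slow D F ->
  slow D (iter q (avgstep N eps) F) /\
  forall j, sdist (iter q (avgstep N eps) F j) (F j) <= q%:R * (D / 2).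
Proof.
move=> sF; elim: q => [|q [IH1 IH2]] /=.
  by split => // j; rewrite sdistAA mul0r.
have [s1 s2] := avgstep_slow IH1; split => // j.
apply: (le_trans (isJ_sdist_tri (s1.1 j) (IH1.1 j) (sF.1 j))).
by rewrite -natr1 mulrDl mul1r addrC lerD.
Qed.

Lemma slow_shift D F (q : nat) j : slow D F -> sdist (F (j - q%:Z)) (F j) <= q%:R * D.
Proof.
move=> [JF FD]; elim: q j => [|q IH] j; first by rewrite subr0 sdistAA mul0r.
have jE : j - q.+1%:Z + 1 = j - q%:Z by lia.
have := isJ_sdist_tri (JF (j - q.+1%:Z)) (JF (j - q%:Z)) (JF j).
move=> tri; apply: (le_trans tri).
by rewrite -natr1 mulrDl mul1r addrC lerD// -jE.
Qed.

(** After refinement the bound is [D / 2]. Refinement moves by at most [D / 2], the [m.-1] smoothing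
    steps by [D / 4] each, and the index shift by at most [m.-1] times [D / 4]; [m%:R * D] is a
    generous bound for the total. *)
Lemma spline_step_slow m D F : (1 <= m)%N -> slow D F ->
  slow (D / 2) (spline_step N eps m F) /\
  forall j, sdist (spline_step N eps m F j) (F (j %/ 2)%Z) <= m%:R * D.
Proof.
move=> m1 sF; have [s0 d0] := refine0_slow sF.
have [s1 d1] := iter_avgstep_slow m.-1 s0.
have D0 : 0 <= D by apply: le_trans (sF.2 0); exact: meas_ge0.
split.
  split=> [j|j]; first exact: s1.1.
  by rewrite /spline_step addrAC; exact: s1.2.
move=> j; rewrite /spline_step; set q := m.-1; set r := (m.-1)./2.
have h1 := d1 (j - r%:Z); have h2 := slow_shift r j s0; have h3 := d0 j.
have h4 := isJ_sdist_tri (s1.1 (j - r%:Z)) (s0.1 (j - r%:Z)) (s0.1 j).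
have h5 := isJ_sdist_tri (s1.1 (j - r%:Z)) (s0.1 j) (sF.1 (j %/ 2)%Z).
have mE : m%:R = q%:R + 1 :> R by rewrite natr1 prednK.
have rq : r%:R <= q%:R / 2 :> R.
  rewrite ler_pdivlMr// -natrM ler_nat muln2 /r -/q.
  by rewrite -[leqRHS]odd_double_half leq_addl.
have : r%:R * D <= q%:R / 2 * D by rewrite ler_wpM2r.
have : 0 <= q%:R * D by rewrite mulr_ge0.
move=> h6 h7; apply: (le_trans h5).
apply: (le_trans (lerD (le_trans h4 (lerD h1 h2)) h3)).
move: D0 h6 h7; rewrite -/q mE; move: (q%:R : R) (r%:R : R) => x y.
by clear=> D0 h6 h7; lra.
Qed.

Section Levels.
Variables (m : nat) (F0 : int -> set pt) (D : R).
Hypotheses (m1 : (1 <= m)%N) (sF : slow D F0).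

Lemma spline_level_slow k : slow (D / 2 ^+ k) (spline_level N eps m F0 k).
Proof.
elim: k => [|k IH]; first by rewrite expr0 divr1.
have := (spline_step_slow m1 IH).1; rewrite exprSr invfM mulrA.
by [].
Qed.

(** The cell of a point at one level is half of its cell at the previous level, so the
    level-to-level estimate can be followed along a fixed point. *)
Lemma floor_double (y : R) : (Num.floor (y * 2) %/ 2)%Z = Num.floor y.
Proof.
have h1 : Num.floor y * 2 <= Num.floor (y * 2).
  by rewrite floor_ge_int rmorphM/= ler_pM2r//; case/andP: (floor_itv y).
have h2 : Num.floor (y * 2) < (Num.floor y + 1) * 2.
  by rewrite floor_lt_int rmorphM/= ltr_pM2r//; case/andP: (floor_itv y).
by lia.
Qed.

Let a (x : R) k := spline_level N eps m F0 k (Num.floor (x * 2 ^+ k)).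

(** The right-hand side is the partial sum of the moves [m%:R * D / 2 ^+ j] over [j < k]. *)
Lemma level_dist x k : sdist (a x k) (a x 0) <= 2 * m%:R * D * (1 - 2^-1 ^+ k).
Proof.
elim: k => [|k IH]; first by rewrite sdistAA expr0 subrr mulr0.
have Jl k' i := (spline_level_slow k').1 i.
have := (spline_step_slow m1 (spline_level_slow k)).2 (Num.floor (x * 2 ^+ k.+1)).
rewrite {2}exprSr mulrA floor_double -/(a x k) => h1.
have h2 := isJ_sdist_tri (Jl k.+1 (Num.floor (x * 2 ^+ k.+1)))
  (Jl k (Num.floor (x * 2 ^+ k))) (Jl 0%N (Num.floor (x * 2 ^+ 0))).
apply: (le_trans h2); apply: (le_trans (lerD h1 IH)).
by rewrite exprS -exprVn; lra.
Qed.

Lemma interp_dist x k : isJ (interp N eps m F0 k x) /\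
  sdist (interp N eps m F0 k x) (F0 (Num.floor x)) <= (2 * m%:R + 1) * D.
Proof.
have D0 : 0 <= D by apply: le_trans (sF.2 0); exact: meas_ge0.
have [Jl dl] := spline_level_slow k.
rewrite /interp; set i := Num.floor _; set lam := _ - _.
have /andP[lam0 lam1] : 0 <= lam <= 1.
  have := floor_itv (x * 2 ^+ k); rewrite /lam -/i intrD => /andP[h1 h2]; apply/andP; split; lra.
have [JM h1 _] := mavg_spec N1 eps0 (introT andP (conj lam0 lam1)) (Jl i) (Jl (i + 1)).
split => //.
have := level_dist x k; rewrite /a -/i expr0 mulr1 => h2.
apply: (le_trans (isJ_sdist_tri JM (Jl i) (sF.1 _))).
have h3 := dl i.
have p0 : 0 <= 2^-1 ^+ k :> R by rewrite exprn_ge0.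
have p1 : 2^-1 ^+ k <= 1 :> R by rewrite exprn_ile1//; lra.
have h4 : D / 2 ^+ k <= D by rewrite -exprVn ler_piMr.
apply: (le_trans (lerD h1 h2)); move: h3.
have := meas_ge0 (symdiff (spline_level N eps m F0 k i) (spline_level N eps m F0 k (i + 1))).
rewrite -/(sdist _ _); move: (sdist _ _) => d d0 dD.
have h6 : (1 - lam) * d <= D by nra.
have h7 : 2 * m%:R * D * (1 - 2^-1 ^+ k) <= 2 * m%:R * D.
  by rewrite ler_piMr ?mulr_ge0//; lra.
lra.
Qed.

End Levels.

Lemma dmu_tri B A C : (dmu A C <= dmu A B + dmu B C)%E.
Proof. by apply: le_trans (lebU _ _); apply: le_leb; exact: symdiff_tri. Qed.

Lemma dmuC A B : dmu A B = dmu B A.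
Proof. by rewrite /dmu symdiffC. Qed.

Lemma dmu_sdist A B : isJ A -> isJ B -> dmu A B = (sdist A B)%:E.
Proof. by move=> [bA _] [bB _]; apply: measE; exact: bounded_symdiff. Qed.

End Scheme.

Unset Implicit Arguments.

Theorem mainTheorem11 (R : realType) (m : nat) (L : R) :
  (1 <= m)%N ->
  exists C : R,
  forall (n : nat) (N eps : R), (0 < n)%N -> 1 <= N -> 0 < eps ->
  forall (G : R -> set 'rV[R]_n) (h delta : R) (F0 : int -> set 'rV[R]_n),
    (forall x, leb_measurable (G x) /\ (leb (G x) < +oo)%E) ->
    (forall x y, (dmu (G x) (G y) <= (L * `|x - y|)%:E)%E) ->
    0 < h -> 0 <= delta < h ->
    (forall i : int, isJ (F0 i) /\ dmu (F0 i) (G (delta + i%:~R * h)) = 0%E) ->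
    forall (x : R) (k : nat),
      (dmu (G x) (interp N eps m F0 k ((x - delta) / h)) <= (C * h)%:E)%E.
Proof.
(* [2 * m%:R + 1] comes from [interp_dist], and the last unit from the distance between [x] and the
   sample point on its left. *)
move=> m1; exists (L * (2 * m%:R + 2)) => -[//|n] N eps _ N1 eps0.
move=> G h delta F0 _ GL h0 _ FG x k.
have JF i := (FG i).1; have FG0 i := (FG i).2.
(* The Lipschitz bound at two points of distance 1 forces this. *)
have L0 : 0 <= L.
  have := GL 1 0; rewrite subr0 normr1 mulr1 -lee_fin; apply: le_trans.
  exact: leb_ge0.
pose c i := delta + i%:~R * h.
(* The samples agree with [G] on the grid up to null sets, and neighbouring grid points are [h]
   apart. *)
have sF : slow (L * h) F0.
  split=> // i; rewrite -lee_fin -dmu_sdist//.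
  apply: (le_trans (dmu_tri (G (c i)) _ _)); rewrite FG0 add0e.
  apply: (le_trans (dmu_tri (G (c (i + 1))) _ _)).
  rewrite [X in (_ + X)%E]dmuC FG0 adde0; apply: (le_trans (GL _ _)).
  rewrite lee_fin /c intrD (_ : _ - _ = - h); last by ring.
  by rewrite normrN gtr0_norm.
set y := (x - delta) / h; have yh : y * h = x - delta by rewrite /y divfK ?gt_eqF.
have [JI Id] := interp_dist N1 eps0 m1 sF y k.
apply: (le_trans (dmu_tri (G (c (Num.floor y))) _ _)).
have h1 : (dmu (G x) (G (c (Num.floor y))) <= (L * h)%:E)%E.
  apply: (le_trans (GL _ _)); rewrite lee_fin ler_wpM2l//.
  have := floor_itv y; rewrite intrD => /andP[f1 f2].
  have -> : x - c (Num.floor y) = (y - (Num.floor y)%:~R) * h.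
    by rewrite mulrBl yh /c; ring.
  by rewrite normrM (gtr0_norm h0) ler_piMl ?(ltW h0)// ger0_norm; lra.
have h2 : (dmu (G (c (Num.floor y))) (interp N eps m F0 k y) <=
    ((2 * m%:R + 1) * (L * h))%:E)%E.
  apply: (le_trans (dmu_tri (F0 (Num.floor y)) _ _)).
  by rewrite dmuC FG0 add0e dmuC dmu_sdist// lee_fin.
apply: (le_trans (leeD h1 h2)); rewrite -EFinD lee_fin.
by rewrite le_eqVlt; apply/orP; left; apply/eqP; ring.
Qed.
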